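(* Let $n\ge2$. Let $w\in(E\cup T)^+$, and suppose $\overline w=w\phi$ has transversal blocks $A_i\cup B_i'$ ($1\le i\le r$), upper non-transversal blocks $C_j$ ($1\le j\le p$) and lower non-transversal blocks $D_k'$ ($1\le k\le q$), where $A_i,B_i,C_j,D_k\subseteq\mathbf n$. Put $\varepsilon=\ker(\overline w)$ and $\eta=\operatorname{coker}(\overline w)$, and let $\alpha\in\mathcal I_n$ be the partial permutation with transversal blocks $\{a_i,b_i'\}$ ($1\le i\le r$), all other blocks being singletons, where $a_i=\min(A_i)$ and $b_i=\min(B_i)$ for each $i$. Then $w\sim t_\varepsilon z_\alpha t_\eta$.
   Context: Write $\mathbf n=\{1,\dots,n\}$, $\mathbf n'=\{1',\dots,n'\}$, and $A'=\{a':a\in A\}$ for $A\subseteq\mathbf n$. The partition monoid $\mathcal P_n$ is the set of all set partitions of $\mathbf n\cup\mathbf n'$. To form $\alpha\beta$, take a copy $\mathbf n''$ of $\mathbf n$, replace each $x'$ by $x''$ in $\alpha$ and each $x$ by $x''$ in $\beta$, take the finest equivalence on $\mathbf n\cup\mathbf n''\cup\mathbf n'$ identifying elements lying in a common block of the modified $\alpha$ or of the modified $\beta$, and restrict it to $\mathbf n\cup\mathbf n'$. A block is transversal if it meets both $\mathbf n$ and $\mathbf n'$; otherwise it is upper (contained in $\mathbf n$) or lower (contained in $\mathbf n'$) non-transversal. $\operatorname{rank}(\alpha)$ is the number of transversal blocks. $\ker(\alpha)=\{(x,y)\in\mathbf n\times\mathbf n: x,y\text{ in the same block of }\alpha\}$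 and $\operatorname{coker}(\alpha)=\{(x,y)\in\mathbf n\times\mathbf n: x',y'\text{ in the same block of }\alpha\}$. $\mathcal S_n$ is the set of partitions of rank $n$ (the group of units). $\mathcal I_n\subseteq\mathcal P_n$ is the set of partitions each of whose blocks meets $\mathbf n$ in at most one point and $\mathbf n'$ in at most one point (partial permutations). $E=\{e_r:1\le r\le n\}$ and $T=\{t_{ij}:1\le i<j\le n\}$ are alphabets, with $t_{ji}=t_{ij}$. $\phi:(E\cup T)^+\to\mathcal P_n\setminus\mathcal S_n$ is the homomorphism with $e_r\phi=\overline e_r$ (blocks $\{r\},\{r'\}$ and $\{x,x'\}$ for $x\ne r$) and $t_{ij}\phi=\overline t_{ij}$ (blocks $\{i,j,i',j'\}$ and $\{x,x'\}$ for $x\notin\{i,j\}$). Write $\overline w=w\phi$. $\sim$ is the congruence on $(E\cup T)^+$ generated by the following relations (subscripts of each letter $t$ distinct): (R1) $e_i^2=e_i$; (R2) $e_ie_j=e_je_i$ for distinct $i,j$; (R3) $t_{ij}^2=t_{ij}$; (R4) $t_{ij}t_{kl}=t_{kl}t_{ij}$; (R5) $t_{ij}t_{jk}=t_{jk}t_{ki}$ for distinct $i,j,k$; (R6) $t_{ij}e_k=e_kt_{ij}$ if $k\notin\{i,j\}$; (R7) $t_{ij}e_kt_{ij}=t_{ij}$ if $k\in\{i,j\}$; (R8) $e_kt_{ij}e_k=e_k$ if $k\in\{i,j\}$; (R9) $e_kt_{ki}e_it_{ij}e_jt_{jk}e_k=e_kt_{kj}e_jt_{ji}e_it_{ik}e_k$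 for distinct $i,j,k$; (R10) $e_kt_{ki}e_it_{ij}e_jt_{jl}e_lt_{lk}e_k=e_kt_{kl}e_lt_{li}e_it_{ij}e_jt_{jk}e_k$ for distinct $i,j,k,l$. For $i\ne j$ put $z_{ij}=e_it_{ij}e_j\in(E\cup T)^+$, let $Z=\{z_{ij}:i,j\in\mathbf n,\ i\ne j\}$, and let $\langle Z\rangle$ be the subsemigroup of $(E\cup T)^+$ generated by $Z$. It is known that $\phi$ maps $\langle Z\rangle$ onto $\mathcal I_n\setminus\mathcal S_n$; for each $\alpha\in\mathcal I_n\setminus\mathcal S_n$, $z_\alpha$ denotes a fixed (arbitrarily chosen) word in $\langle Z\rangle$ with $z_\alpha\phi=\alpha$. For $A\subseteq\mathbf n$ let $t_A=1$ (the empty word) if $|A|\le1$, and $t_A=t_{i_1i_2}t_{i_2i_3}\cdots t_{i_{k-1}i_k}$ if $A=\{i_1<\cdots<i_k\}$ with $k\ge2$. For an equivalence $\varepsilon$ on $\mathbf n$ with classes $A_1,\dots,A_m$, where $\min(A_1)<\cdots<\min(A_m)$, let $t_\varepsilon=t_{A_1}\cdots t_{A_m}\in T^*$. *)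

(* Defs.v *)
From HB Require Import structures.
From mathcomp Require Import all_boot.

Set Implicit Arguments.
Unset Strict Implicit.
Unset Printing Implicit Defensive.

(** * The partition monoid *)

(* The set n is represented by 'I_n, i.e. {0, ..., n-1} with its usual order.
   In [vertex n], [inl x] is the upper point x and [inr x] the lower point x'. *)
Notation vertex n := ('I_n + 'I_n)%type.

Record ptn (n : nat) := Ptn {
  blocks :> {set {set vertex n}};
  blocksP : partition blocks [set: vertex n] }.

HB.instance Definition _ n := [isSub for @blocks n].
HB.instance Definition _ n := [Finite of ptn n by <:].

Section PartitionMonoid.

Variable n : nat.
Implicit Types (al be : ptn n) (X : {set vertex n}).

Definition upper (A : {set 'I_n}) : {set vertex n} := [set inl x | x in A].
Definition lower (A : {set 'I_n}) : {set vertex n} := [set inr x | x in A].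

(* In [vertex n + 'I_n], the points x, x'' and x' are [inl (inl x)],
   [inl (inr x)] and [inr x] respectively. *)
Definition emb_left (u : vertex n) : vertex n + 'I_n := inl u.

Definition emb_right (u : vertex n) : vertex n + 'I_n :=
  match u with inl x => inl (inr x) | inr x => inr x end.

Definition emb_outer (u : vertex n) : vertex n + 'I_n :=
  match u with inl x => inl (inl x) | inr x => inr x end.

Definition prod_edge al be : rel (vertex n + 'I_n) := fun u v =>
  [exists X in blocks al, (u \in emb_left @: X) && (v \in emb_left @: X)]
  || [exists X in blocks be, (u \in emb_right @: X) && (v \in emb_right @: X)].

Definition prod_rel al be : rel (vertex n) := fun u v =>
  connect (prod_edge al be) (emb_outer u) (emb_outer v).

Lemma prod_edge_sym al be : symmetric (prod_edge al be).
Proof.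
by move=> u v; congr (_ || _); apply: eq_existsb => X; rewrite andbA andbAC andbA.
Qed.

Lemma prod_rel_equiv al be :
  {in [set: vertex n] & &, equivalence_rel (prod_rel al be)}.
Proof.
move=> u v w _ _ _; split; first exact: connect0.
by move/(same_connect (sym_connect_sym (@prod_edge_sym al be)))=> h; exact: h.
Qed.

Definition ptn_mul al be : ptn n :=
  Ptn (equivalence_partitionP (@prod_rel_equiv al be)).

Lemma ptn_intro (P : {set {set vertex n}}) :
    (forall X, X \in P -> X != set0) ->
    (forall u, exists2 X, X \in P & u \in X) ->
    (forall X Y u, X \in P -> Y \in P -> u \in X -> u \in Y -> X = Y) ->
  partition P [set: vertex n].
Proof.
move=> ne cov inj; apply/and3P; split.
- by rewrite eqEsubset subsetT; apply/subsetP=> u _; apply/bigcupP; exact: cov.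
- apply/trivIsetP=> X Y PX PY; apply: contraR => /pred0Pn[u /andP[uX uY]].
  by apply/eqP; exact: inj PX PY uX uY.
- by apply/negP=> /ne; rewrite eqxx.
Qed.

Definition blocks_one : {set {set vertex n}} :=
  [set [set inl x; inr x] | x : 'I_n].

Definition blocks_e (r : 'I_n) : {set {set vertex n}} :=
  [set [set inl r]; [set inr r]]
  :|: [set [set inl x; inr x] | x : 'I_n & x != r].

Definition blocks_t (i j : 'I_n) : {set {set vertex n}} :=
  [set inl i; inl j; inr i; inr j]
  |: [set [set inl x; inr x] | x : 'I_n & x \notin [set i; j]].

Lemma blocks_oneP : partition blocks_one [set: vertex n].
Proof.
apply: ptn_intro
  => [X /imsetP[x _ ->] | u | X Y u /imsetP[x _ ->] /imsetP[y _ ->]].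
- by apply/set0Pn; exists (inl x); rewrite !inE eqxx.
- case: u => x; exists [set inl x; inr x]; try exact: imset_f.
  + by rewrite !inE eqxx.
  + by rewrite !inE eqxx orbT.
- by case: u => u; rewrite !inE ?orbF //= => /eqP[<-] /eqP[<-].
Qed.

Lemma blocks_eP r : partition (blocks_e r) [set: vertex n].
Proof.
apply: ptn_intro.
- move=> X /setUP[/set2P[]-> | /imsetP[x _ ->]]; apply/set0Pn.
  + by exists (inl r); rewrite inE.
  + by exists (inr r); rewrite inE.
  + by exists (inl x); rewrite !inE eqxx.
- move=> u; case: (boolP (u \in [set inl r; inr r])) => [|].
    by case/set2P=> ->; [exists [set inl r] | exists [set inr r]];
       rewrite !inE ?eqxx ?orbT.
  case: u => x; rewrite !inE ?orbF /= => neq; exists [set inl x; inr x];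
    rewrite ?inE ?eqxx ?orbT //; apply/orP; right; apply/imsetP; exists x;
    by rewrite ?inE.
- have sep (x : 'I_n) u : x \in [set x | x != r] -> u \in [set inl x; inr x] ->
      (u \in [set inl r]) || (u \in [set inr r]) -> False.
    rewrite !inE => /eqP xr.
    by case: u => u; rewrite ?orbF /= => /eqP[->] /eqP[/xr].
  move=> X Y u /setUP[/set2P[]-> | /imsetP[x xr ->]]
    /setUP[/set2P[]-> | /imsetP[y yr ->]] //.
  + by move=> /set1P-> /set1P.
  + by move=> uX /(sep _ _ yr); rewrite uX; case.
  + by move=> /set1P-> /set1P.
  + by move=> uX /(sep _ _ yr); rewrite uX orbT; case.
  + by move=> /(sep _ _ xr) h uY; case: h; rewrite uY.
  + by move=> /(sep _ _ xr) h uY; case: h; rewrite uY orbT.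
  + by case: u => u; rewrite !inE ?orbF //= => /eqP[<-] /eqP[<-].
Qed.

Lemma blocks_tP i j : partition (blocks_t i j) [set: vertex n].
Proof.
apply: ptn_intro.
- move=> X /setU1P[-> | /imsetP[x _ ->]]; apply/set0Pn.
  + by exists (inl i); rewrite !inE eqxx.
  + by exists (inl x); rewrite !inE eqxx.
- move=> u; pose x := match u with inl x => x | inr x => x end.
  have [xij | xNij] := boolP (x \in [set i; j]).
    exists [set inl i; inl j; inr i; inr j]; first exact: setU11.
    by move: xij; rewrite {}/x; case: u => u /set2P[]->; rewrite !inE eqxx ?orbT.
  exists [set inl x; inr x].
    by apply/setU1P; right; apply: imset_f; rewrite inE.
  by rewrite /x; case: (u) => v; rewrite !inE eqxx ?orbT.
- have sep (x : 'I_n) u : x \in [set x | x \notin [set i; j]] ->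
      u \in [set inl x; inr x] ->
      u \in [set inl i; inl j; inr i; inr j] -> False.
    rewrite !inE negb_or => /andP[/eqP xi /eqP xj].
    by case: u => u; rewrite ?orbF /= => /eqP[->];
       do ?[case/orP] => /eqP[]; move=> ?; subst.
  move=> X Y u /setU1P[-> | /imsetP[x xN ->]] /setU1P[-> | /imsetP[y yN ->]] //.
  + by move=> uX /(sep _ _ yN); case.
  + by move=> /(sep _ _ xN) h /h.
  + by case: u => u; rewrite !inE ?orbF //= => /eqP[<-] /eqP[<-].
Qed.

Definition ptn_one : ptn n := Ptn blocks_oneP.
Definition ptn_e (r : 'I_n) : ptn n := Ptn (blocks_eP r).
Definition ptn_t (i j : 'I_n) : ptn n := Ptn (blocks_tP i j).

Definition is_transv X : bool :=
  (X :&: upper [set: 'I_n] != set0) && (X :&: lower [set: 'I_n] != set0).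

Definition rank al : nat := #|[set X in blocks al | is_transv X]|.

Definition ker al : rel 'I_n := fun x y =>
  [exists X in blocks al, (inl x \in X) && (inl y \in X)].

Definition coker al : rel 'I_n := fun x y =>
  [exists X in blocks al, (inr x \in X) && (inr y \in X)].

Definition in_Sn : {pred ptn n} := fun al => rank al == n.

Definition in_In : {pred ptn n} := fun al =>
  [forall X in blocks al, (#|X :&: upper [set: 'I_n]| <= 1)
                          && (#|X :&: lower [set: 'I_n]| <= 1)].

(* The non-transversal blocks of [al] are the [upper (C j)] and
   [lower (D k)], and its transversal blocks are the A_i \cup B_i'; each block
   is listed exactly once. *)
Definition has_blocks al (r p q : nat) (A B : 'I_r -> {set 'I_n})
    (C : 'I_p -> {set 'I_n}) (D : 'I_q -> {set 'I_n}) : Prop :=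
  [/\ blocks al = [set upper (A i) :|: lower (B i) | i : 'I_r]
                  :|: [set upper (C j) | j : 'I_p]
                  :|: [set lower (D k) | k : 'I_q],
      forall i, A i != set0 /\ B i != set0,
      injective (fun i => upper (A i) :|: lower (B i)),
      injective C
    & injective D].

Definition is_min (A : {set 'I_n}) (a : 'I_n) : Prop :=
  a \in A /\ forall x, x \in A -> a <= x.

End PartitionMonoid.

Arguments in_Sn : clear implicits.
Arguments in_In : clear implicits.

(** * Words, the homomorphism phi and the congruence *)

Inductive letter (n : nat) : Type :=
  | LE of 'I_n
  | LT of {ij : 'I_n * 'I_n | ij.1 < ij.2}.

(* (E \cup T)^* is [word n] with concatenation; (E \cup T)^+ consists of the
   words distinct from [::]. *)
Notation word n := (seq (letter n)).

Section Words.

Variable n : nat.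
Implicit Types (i j k l r : 'I_n) (u v w : word n) (A : {set 'I_n}).

Definition e_ r : word n := [:: LE r].

(* The one-letter word t_{ij} = t_{ji}; [t_ i i] is a junk value (the empty
   word). *)
Definition t_ i j : word n :=
  if insub (i, j) is Some ij then [:: LT ij]
  else if insub (j, i) is Some ji then [:: LT ji] else [::].

Definition phi_letter (x : letter n) : ptn n :=
  match x with
  | LE r => ptn_e r
  | LT ij => ptn_t (val ij).1 (val ij).2
  end.

(* Extended to (E \cup T)^* by sending the empty word to the identity. *)
Definition phi w : ptn n :=
  foldr (fun x al => ptn_mul (phi_letter x) al) (ptn_one n) w.

Inductive rel_R : word n -> word n -> Prop :=
  | R1 i : rel_R (e_ i ++ e_ i) (e_ i)
  | R2 i j : i != j -> rel_R (e_ i ++ e_ j) (e_ j ++ e_ i)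
  | R3 i j : i != j -> rel_R (t_ i j ++ t_ i j) (t_ i j)
  | R4 i j k l : i != j -> k != l -> rel_R (t_ i j ++ t_ k l) (t_ k l ++ t_ i j)
  | R5 i j k : uniq [:: i; j; k] -> rel_R (t_ i j ++ t_ j k) (t_ j k ++ t_ k i)
  | R6 i j k : i != j -> k \notin [set i; j] ->
      rel_R (t_ i j ++ e_ k) (e_ k ++ t_ i j)
  | R7 i j k : i != j -> k \in [set i; j] ->
      rel_R (t_ i j ++ e_ k ++ t_ i j) (t_ i j)
  | R8 i j k : i != j -> k \in [set i; j] ->
      rel_R (e_ k ++ t_ i j ++ e_ k) (e_ k)
  | R9 i j k : uniq [:: i; j; k] ->
      rel_R (e_ k ++ t_ k i ++ e_ i ++ t_ i j ++ e_ j ++ t_ j k ++ e_ k)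
            (e_ k ++ t_ k j ++ e_ j ++ t_ j i ++ e_ i ++ t_ i k ++ e_ k)
  | R10 i j k l : uniq [:: i; j; k; l] ->
      rel_R (e_ k ++ t_ k i ++ e_ i ++ t_ i j ++ e_ j ++ t_ j l ++ e_ l ++ t_ l k
               ++ e_ k)
            (e_ k ++ t_ k l ++ e_ l ++ t_ l i ++ e_ i ++ t_ i j ++ e_ j ++ t_ j k
               ++ e_ k).

(* The congruence on (E \cup T)^+: since both sides of every relation are
   nonempty, [sim] only relates nonempty words. *)
Inductive sim : word n -> word n -> Prop :=
  | sim_rel u v : rel_R u v -> sim u v
  | sim_refl u : u <> [::] -> sim u u
  | sim_sym u v : sim u v -> sim v u
  | sim_trans u v w : sim u v -> sim v w -> sim u w
  | sim_mull w u v : sim u v -> sim (w ++ u) (w ++ v)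
  | sim_mulr w u v : sim u v -> sim (u ++ w) (v ++ w).

Definition z_ i j : word n := e_ i ++ t_ i j ++ e_ j.

Inductive in_gen_Z : word n -> Prop :=
  | gen_Z_z i j : i != j -> in_gen_Z (z_ i j)
  | gen_Z_mul u v : in_gen_Z u -> in_gen_Z v -> in_gen_Z (u ++ v).

(* [enum A] lists A in increasing order. *)
Definition t_set A : word n :=
  if enum A is i :: s then flatten (pairmap t_ i s) else [::].

(* The minima of the classes of [eps], in increasing order, index the
   classes. *)
Definition t_eqv (eps : rel 'I_n) : word n :=
  flatten [seq t_set [set y | eps x y]
          | x <- enum 'I_n & [forall y, eps x y ==> (x <= y)]].

End Words.

(* Main.v *)
From Corelib Require Import Setoid Morphisms.
Require Import Defs.
From mathcomp Require Import all_boot fingroup perm.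

Set Implicit Arguments.
Unset Strict Implicit.
Unset Printing Implicit Defensive.

(** The relations of the congruence present the singular partition monoid: two
nonempty words with the same image under [phi] are congruent, and the word
on the right of the theorem has the same image as [w].  What has to be
understood is why the relations suffice.

Write [z_ i j] = e_i t_ij e_j.  Its image moves the token at position j to
the position i, which is emptied first: it is a move of a sliding puzzle on
the complete graph, in which some positions are holes.  A product of such moves
([moves]) is a partial permutation: it is determined by the set of upper points
whose token is lost ([hole]) and by where the other tokens go ([move_perm]).
Products of moves with the same image are congruent ([moves_complete]).  By
an inverse-semigroup argument it is enough to treat products whose image is
idempotent.  Such a product follows the walk of one hole from k to l
([moves_walk]), and so is a product of triangular loops k-i-j-k followed by
one step from k to l ([walk_loops]).  A loop acts as the transposition of i and
j; (R9) makes it symmetric in i and j, and (R10) says that loops are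
conjugated by each other as transpositions are.  The usual proof that
transpositions, with these relations, present the symmetric group then applies:
every point p that carries a token is pushed out of the word ([taus_elim]),
until only loops through holes are left, and those are absorbed
([taus_trivial]).

The words in the letters t are dealt with by absorption: [t_ x y ++ w] is
congruent to [w] as soon as x and y lie in the same kernel class of [w]
([t_kernel]), and dually.  Every word is congruent to a product of t letters, then
moves, then t letters ([factorisation]); absorbing the outer factors, [w]
is congruent to [t_eqv ker ++ moves M ++ t_eqv coker] ([factors_exists]).
Relations (R7) and (R8) then allow the moves to be altered until they only
carry minima of kernel classes to minima of cokernel classes
([factors_normal]).  At that point the partial permutation given by the moves
is the alpha of the theorem, and [moves_complete] concludes.

Images are compared through a faithful representation by relations: a
word w relates the two-colourings f and g of the upper and lower points when
together they are constant on the blocks of [phi w].  Products become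
compositions of relations, so that soundness needs neither the associativity of
the product nor a computation of blocks ([sim_sound], [crel_phi]). *)

(** * The congruence as an equality on words *)

(** The congruence of the theorem relates only nonempty words; adding equality
makes it reflexive on the empty word too, hence a congruence of the free
monoid, which is what rewriting inside concatenations requires. *)
Definition eqv n (u v : word n) := u = v \/ sim u v.
Notation "u ~= v" := (eqv u v) (at level 70).

#[global] Instance eqv_equiv n : Equivalence (@eqv n).
Proof.
split.
- by move=> u; left.
- by move=> u v [->|h]; [left | right; apply: sim_sym].
- move=> u v w [->|h] // [<-|h']; right => //; exact: sim_trans h h'.
Qed.

#[global] Instance eqv_cat n : Proper (@eqv n ==> @eqv n ==> @eqv n) cat.
Proof.
move=> u u' [<-|h] v v' [<-|h']; [by left | right..].
- exact: sim_mull.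
- exact: sim_mulr.
- exact: sim_trans (sim_mulr v h) (sim_mull u' h').
Qed.

#[global] Hint Extern 0 (eqv _ _) => reflexivity : core.

Lemma eqv_sim n (u v : word n) : u <> [::] -> u ~= v -> sim u v.
Proof. by move=> u0 [<-|//]; apply: sim_refl. Qed.

(** Most congruences below carry a tail [r]: with concatenations associated to
the right, this is the form in which they rewrite in the middle of a word. *)
Section Letters.
Variable n : nat.
Implicit Types (u v w r : word n) (i j k l x y a b c : 'I_n).

Lemma rel_R_eqv u v r : rel_R u v -> u ++ r ~= v ++ r.
Proof. by move=> h; right; apply/sim_mulr/sim_rel. Qed.

Lemma t_refl i : t_ i i = [::].
Proof. by rewrite /t_ insubF //= ltnn. Qed.

Lemma t_sym i j : t_ i j = t_ j i.
Proof.
case: (ltngtP i j) => [ij|ji|/val_inj->] //; rewrite /t_.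
- by rewrite insubT // [in RHS]insubF //= ltnNge ltnW.
- by rewrite insubF ?insubT //= ltnNge ltnW.
Qed.

Lemma ee i r : e_ i ++ e_ i ++ r ~= e_ i ++ r.
Proof. by rewrite catA; apply/rel_R_eqv/R1. Qed.

Lemma eeC i j r : e_ i ++ e_ j ++ r ~= e_ j ++ e_ i ++ r.
Proof.
by case: (eqVneq i j) => [->//|ij]; rewrite !catA; apply/rel_R_eqv/R2.
Qed.

Lemma ttK i j r : t_ i j ++ t_ i j ++ r ~= t_ i j ++ r.
Proof.
case: (eqVneq i j) => [->|ij]; first by rewrite t_refl.
by rewrite catA; apply/rel_R_eqv/R3.
Qed.

Lemma ttC i j k l r : t_ i j ++ t_ k l ++ r ~= t_ k l ++ t_ i j ++ r.
Proof.
case: (eqVneq i j) => [->|ij]; first by rewrite t_refl.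
case: (eqVneq k l) => [->|kl]; first by rewrite t_refl.
by rewrite !catA; apply/rel_R_eqv/R4.
Qed.

(** (R5), including its degenerate cases, where [t_ i i] is empty. *)
Lemma tt_tri i j k r : t_ i j ++ t_ j k ++ r ~= t_ j k ++ t_ k i ++ r.
Proof.
case: (eqVneq i j) => [->|ij].
  by rewrite t_refl (t_sym k j) ttK.
case: (eqVneq i k) => [->|ik].
  by rewrite t_refl (t_sym k j) ttK.
case: (eqVneq j k) => [->|jk]; first by rewrite t_refl (t_sym i k).
by rewrite !catA; apply/rel_R_eqv/R5; rewrite /= !inE negb_or ij ik jk.
Qed.

Lemma teC i j k r : k != i -> k != j ->
  t_ i j ++ e_ k ++ r ~= e_ k ++ t_ i j ++ r.
Proof.
move=> ki kj; case: (eqVneq i j) => [->|ij]; first by rewrite t_refl.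
by rewrite !catA; apply/rel_R_eqv/R6; rewrite // !inE negb_or ki kj.
Qed.

Lemma tet i j r : i != j -> t_ i j ++ e_ i ++ t_ i j ++ r ~= t_ i j ++ r.
Proof.
move=> ij; have h : i \in [set i; j] by rewrite !inE eqxx.
by have := rel_R_eqv r (R7 ij h); rewrite -!catA.
Qed.

Lemma ete i j r : i != j -> e_ i ++ t_ i j ++ e_ i ++ r ~= e_ i ++ r.
Proof.
move=> ij; have h : i \in [set i; j] by rewrite !inE eqxx.
by have := rel_R_eqv r (R8 ij h); rewrite -!catA.
Qed.

Lemma zE i j r : z_ i j ++ r = e_ i ++ t_ i j ++ e_ j ++ r.
Proof. by rewrite /z_ -!catA. Qed.

Lemma zxx i r : z_ i i ++ r ~= e_ i ++ r.
Proof. by rewrite zE t_refl ee. Qed.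

(** Moving a token forth and back only erases what was at i. *)
Lemma zzK i j r : z_ i j ++ z_ j i ++ r ~= e_ i ++ r.
Proof.
case: (eqVneq i j) => [->|ij]; first by rewrite !zxx ee.
by rewrite !zE ee (t_sym i j) tet 1?eq_sym // t_sym ete.
Qed.

Lemma ez i j r : e_ i ++ z_ i j ++ r ~= z_ i j ++ r.
Proof. by rewrite zE ee. Qed.

Lemma ze i j r : z_ i j ++ e_ j ++ r ~= z_ i j ++ r.
Proof. by rewrite !zE ee. Qed.

(** Erasing a position after a move amounts to erasing before the move the
position that it comes from. *)
Lemma zeC i j x r : z_ i j ++ e_ (tperm i j x) ++ r ~= e_ x ++ z_ i j ++ r.
Proof.
case: (eqVneq i j) => [->|ij].
  by rewrite tperm1 perm1 !zxx eeC.
case: tpermP => [->|->|/eqP xi /eqP xj]; first by rewrite ze ez.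
  rewrite !zE (eeC j i) [X in _ ~= X]eeC (t_sym i j) ete 1?eq_sym //.
  by rewrite t_sym ete.
by rewrite !zE (eeC j x) teC // eeC.
Qed.

(** Moving between two holes does nothing. *)
Lemma eez i j r : e_ i ++ e_ j ++ z_ i j ++ r ~= e_ i ++ e_ j ++ r.
Proof.
rewrite eeC ez; case: (eqVneq i j) => [->|ij]; first by rewrite zxx.
by rewrite zE [X in X ~= _]eeC (t_sym i j) ete 1?eq_sym.
Qed.

(** * Loops of a hole as transpositions *)

Lemma z9 i j k r :
  z_ k i ++ z_ i j ++ z_ j k ++ r ~= z_ k j ++ z_ j i ++ z_ i k ++ r.
Proof.
case: (eqVneq i j) => [->//|ij].
case: (eqVneq k i) => [->|ki]; first by rewrite zxx ez zzK zzK ez zxx.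
case: (eqVneq k j) => [->|kj]; first by rewrite zzK ez zxx zxx ez zzK.
have u : uniq [:: i; j; k] by rewrite /= !inE negb_or ij !(eq_sym _ k) ki kj.
by have := rel_R_eqv r (R9 u); rewrite !zE -!catA !ee.
Qed.

Lemma z10 i j k l r : uniq [:: i; j; k; l] ->
  z_ k i ++ z_ i j ++ z_ j l ++ z_ l k ++ r
    ~= z_ k l ++ z_ l i ++ z_ i j ++ z_ j k ++ r.
Proof. by move=> u; have := rel_R_eqv r (R10 u); rewrite !zE -!catA !ee. Qed.

Definition moves (M : seq ('I_n * 'I_n)) : word n :=
  flatten [seq z_ ij.1 ij.2 | ij <- M].

Lemma moves_cons i j M r : moves ((i, j) :: M) ++ r = z_ i j ++ moves M ++ r.
Proof. by rewrite -catA. Qed.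

Lemma moves_cat M N : moves (M ++ N) = moves M ++ moves N.
Proof. by rewrite /moves map_cat flatten_cat. Qed.

(** With a hole at k, this loop exchanges the tokens at i and j. *)
Definition tau k i j : word n := moves [:: (k, i); (i, j); (j, k)].

Lemma tauE k i j r : tau k i j ++ r = z_ k i ++ z_ i j ++ z_ j k ++ r.
Proof. by rewrite /tau !moves_cons. Qed.

Lemma tauC k i j r : tau k i j ++ r ~= tau k j i ++ r.
Proof. by rewrite !tauE z9. Qed.

Lemma etau k i j r : e_ k ++ tau k i j ++ r ~= tau k i j ++ r.
Proof. by rewrite !tauE ez. Qed.

Lemma taue k i j r : tau k i j ++ e_ k ++ r ~= tau k i j ++ r.
Proof. by rewrite !tauE ze. Qed.

Lemma tau_sq k i j r : tau k i j ++ tau k i j ++ r ~= e_ k ++ r.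
Proof. by rewrite [X in _ ++ X]tauC !tauE zzK ez zzK ez zzK. Qed.

Lemma tau_triv k i j r : [|| i == j, k == i | k == j] ->
  tau k i j ++ r ~= e_ k ++ r.
Proof.
rewrite tauE => /or3P[]/eqP->; first by rewrite zxx ez zzK.
- by rewrite zxx ez zzK.
- by rewrite zzK zxx ee.
Qed.

(** The conjugation relation of transpositions.  Both sides are 4-cycles of the
hole, after the middle of the walk has been backtracked; this is (R10). *)
Lemma tau_conj k i j l r : uniq [:: k; i; j; l] ->
  tau k i j ++ tau k j l ++ r ~= tau k l i ++ tau k i j ++ r.
Proof.
move=> u; rewrite !tauE [X in _ ++ _ ++ X]zzK ez [X in _ ~= _ ++ _ ++ X]zzK ez.
by apply: z10; rewrite (uniq_catCA [:: i; j] [:: k]).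
Qed.

(** Disjoint transpositions commute because (l m) is the conjugate of (i m)
by (l i), and moving (i j) through these three factors only uses the
conjugation relation. *)
Lemma tau_comm k i j l m r : uniq [:: k; i; j; l; m] ->
  tau k i j ++ tau k l m ++ r ~= tau k l m ++ tau k i j ++ r.
Proof.
move=> u.

have [U1 U2 U3 U4] : [/\ uniq [:: k; l; i; m], uniq [:: k; j; i; l],
    uniq [:: k; j; i; m] & uniq [:: k; l; j; m]].
  move: u; rewrite /= !inE !negb_or !andbT -!andbA.
  do 9?[case/andP=> ?]; move=> ?.
  by split; repeat (apply/andP; split); rewrite // eq_sym.
have E : tau k l m ++ r ~= tau k l i ++ tau k i m ++ tau k l i ++ r.
  by rewrite (tau_conj _ U1) tau_sq taue tauC.
rewrite E (tauC k i j) [X in _ ++ X](tauC k l i) (tau_conj _ U2).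
rewrite [X in _ ++ X](tau_conj _ U3) (tauC k l i) (tau_conj _ U2).
by rewrite (tauC k m j) (tau_conj _ U4) tau_sq etau (tauC k m l) (tauC k j i).
Qed.

Lemma tau_star k p y a r : uniq [:: k; p; y; a] ->
  tau k p y ++ tau k p a ++ r ~= tau k p a ++ tau k a y ++ r.
Proof.
move=> u; rewrite tauC -(@tau_conj _ p) //.
move: u; rewrite /= !inE !negb_or (eq_sym a y) !andbT -!andbA.
by case/and5P=> -> -> -> -> /andP[-> ->].
Qed.

Definition loops k (L : seq ('I_n * 'I_n)) : seq ('I_n * 'I_n) :=
  flatten [seq [:: (k, ij.1); ij; (ij.2, k)] | ij <- L].

Definition taus k L : word n := moves (loops k L).

Lemma taus_cons k x y L : taus k ((x, y) :: L) = tau k x y ++ taus k L.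
Proof. by rewrite -moves_cat. Qed.

Definition within (S : pred 'I_n) (L : seq ('I_n * 'I_n)) :=
  all (fun ij => S ij.1 && S ij.2) L.

(** A product of transpositions can be rewritten so that p occurs at most
once, in the first factor: a transposition fixing p is moved to the right of
(p a) at the cost of replacing a, and (p y)(p a) = (p a)(a y). *)
Lemma taus_elim k p (S : pred 'I_n) L : p != k -> within S L ->
  exists2 L', within (fun x => S x && (x != p)) L' &
    e_ k ++ taus k L ~= e_ k ++ taus k L' \/
    exists a, [/\ S a, a != p, a != k &
               e_ k ++ taus k L ~= tau k p a ++ taus k L'].
Proof.
move=> pk; elim: L => [|[x y] L IH]; first by exists [::] => //; left.
case/andP=> /andP[Sx Sy] /IH{IH}[L' wL' IH]; rewrite /= in Sx Sy.
rewrite taus_cons.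
have [tr|] := boolP [|| x == y, k == x | k == y].
  exists L' => //; case: IH => [IH|[a [Sa ap ak IH]]]; [left | right].
    by rewrite tau_triv // ee IH.
  by exists a; split=> //; rewrite tau_triv // ee IH.
rewrite !negb_or => /and3P[xy kx ky].
wlog yp : x y xy kx ky Sx Sy / y != p.
  move=> H; have [yp|] := eqVneq y p; last exact: H.
  subst p; have [||||||L1 wL1 H1] := H y x; rewrite // 1?eq_sym //.
  exists L1 => //; case: H1 => [H1|[a [Sa ay ak H1]]]; [left | right].
    by rewrite tauC.
  by exists a; split; rewrite // tauC.
case: IH => [IH|[a [Sa ap ak IH]]].
  have E : e_ k ++ tau k x y ++ taus k L ~= tau k x y ++ taus k L'.
    by rewrite etau -taue IH taue.
  have [xp|xp] := eqVneq x p.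
    by exists L' => //; right; exists y; split; rewrite // -?xp // eq_sym.
  exists ((x, y) :: L'); first by rewrite /= Sx Sy xp yp.
  by left; rewrite taus_cons E etau.
have E : e_ k ++ tau k x y ++ taus k L ~= tau k x y ++ tau k p a ++ taus k L'.
  by rewrite etau -taue IH.
have [xp|xp] := eqVneq x p.
  have [ay|ay] := eqVneq a y.
    by exists L' => //; left; rewrite E xp ay tau_sq.
  exists ((a, y) :: L'); first by rewrite /= Sa ap Sy yp.
  right; exists a; split=> //; rewrite E xp tau_star ?taus_cons //.
  by rewrite /= !inE !negb_or (eq_sym k a) ak -xp kx ky xy xp !(eq_sym _ a) ap ay.
exists ((x, y) :: L'); first by rewrite /= Sx Sy xp yp.
right; exists (tperm x y a); split.
- by case: tpermP.
- by case: tpermP.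
- by case: tpermP => // _; rewrite eq_sym.
rewrite E taus_cons; case: tpermP => [ax|ay|/eqP ax /eqP ay].
- rewrite ax in ap *; rewrite tauC (tauC k p) tau_conj.
    by rewrite [X in _ ++ X]tauC.
  by rewrite /= !inE !negb_or ky kx (eq_sym k) pk (eq_sym y x) xy xp yp.
- rewrite ay (tauC k p) tau_conj //.
  by rewrite /= !inE !negb_or ky kx (eq_sym k) pk xy xp yp.
apply: tau_comm; rewrite /= !inE !negb_or !(eq_sym k p) !(eq_sym _ a).
by rewrite pk ak ky kx xy xp yp ap ax ay.
Qed.
End Letters.

(** * A faithful representation by relations between colourings *)

Section Semantics.
Variable n : nat.
Implicit Types (u v w : word n) (i j k l x y a b c : 'I_n).
Implicit Types (f g h : {ffun 'I_n -> bool}).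
Local Open Scope group_scope.

(** The relation of a letter holds between a colouring f of the upper points and
a colouring g of the lower points when they are jointly constant on the
blocks of its image. *)
Definition letter_rel (a : letter n) f g : Prop :=
  match a with
  | LE r => forall x, x != r -> f x = g x
  | LT ij => f = g /\ f (val ij).1 = f (val ij).2
  end.

Fixpoint crel w f g : Prop :=
  if w is a :: w' then exists2 h, letter_rel a f h & crel w' h g else f = g.

Lemma crel_cat u v f g : crel (u ++ v) f g <-> exists2 h, crel u f h & crel v h g.
Proof.
elim: u f => [|a u IH] f /=.
  by split=> [h|[h -> //]]; exists f.
split=> [[h fh /IH[h' hh' h'g]]|[h' [h fh hh'] h'g]].
  by exists h' => //; exists h.
by exists h => //; apply/IH; exists h'.
Qed.

Lemma crel_e i f g : crel (e_ i) f g <-> forall x, x != i -> f x = g x.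
Proof. by split=> [[h fh <-]|fg] //; exists g. Qed.

Lemma crel_t i j f g : crel (t_ i j) f g <-> f = g /\ f i = f j.
Proof.
have [ij|ij|/val_inj->] := ltngtP i j; last by rewrite t_refl /=; split=> [|[]].
- rewrite /t_ insubT /=; split=> [[h [<- ?] <-] //|[<- fij]].
  by exists f.
- rewrite t_sym /t_ insubT /=; split=> [[h [<- ?] <-] //|[<- fij]].
  by exists f.
Qed.

Lemma crel_tcat i j w f g : crel (t_ i j ++ w) f g <-> f i = f j /\ crel w f g.
Proof.
rewrite crel_cat; split=> [[h /crel_t[<- //]]|[fij fg]].
by exists f => //; apply/crel_t.
Qed.

Lemma crel_ecat i w f g :
  crel (e_ i ++ w) f g <->
  exists2 h : {ffun _}, (forall x, x != i -> f x = h x) & crel w h g.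
Proof. by []. Qed.

Lemma crel_z i j f g : crel (z_ i j) f g <->
  forall x, x != i -> g (tperm i j x) = f x.
Proof.
rewrite /z_ crel_ecat; split=> [[h fh] /crel_tcat[hij /crel_e hg] x xi|fg].
  rewrite fh //; case: tpermP xi => [->|->|/eqP xi /eqP xj _]; first by rewrite eqxx.
    by move=> ji; rewrite -hij hg // eq_sym.
  by rewrite hg.
exists [ffun x => if x == i then f j else f x].
  by move=> x /negbTE xi; rewrite ffunE xi.
apply/crel_tcat; split; first by rewrite !ffunE eqxx if_same.
apply/crel_e => x xj; rewrite ffunE; case: eqVneq => [xi|xi].
  by rewrite xi in xj *; rewrite -fg ?tpermR // eq_sym.
by rewrite -fg // tpermD // eq_sym.
Qed.

Fixpoint move_perm (M : seq ('I_n * 'I_n)) : {perm 'I_n} :=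
  if M is (i, j) :: M' then tperm i j * move_perm M' else 1.

(** [hole M x]: the token that starts at x is erased by one of the moves. *)
Fixpoint hole (M : seq ('I_n * 'I_n)) x : bool :=
  if M is (i, j) :: M' then (x == i) || hole M' (tperm i j x) else false.

Lemma crel_moves M f g :
  crel (moves M) f g <-> forall x, ~~ hole M x -> g (move_perm M x) = f x.
Proof.
elim: M f => [|[i j] M IH] f.
  split=> [-> x _|fg] /=; first by rewrite perm1.
  by apply/ffunP=> x; rewrite -fg // perm1.
rewrite -[moves _]/(z_ i j ++ moves M) crel_cat.
split=> [[h /crel_z fh /IH hg] x|fg].
  by rewrite /= negb_or permM => /andP[/fh <- /hg ->].
exists [ffun y => if y == j then g (move_perm M y) else f (tperm i j y)].
  apply/crel_z => x xi; rewrite ffunE tpermK.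
  by rewrite -[X in _ == X](tpermL i j) (inj_eq perm_inj) (negbTE xi).
apply/IH => y yM; rewrite ffunE; case: eqVneq => // yj.
rewrite -fg /= ?permM ?tpermK // negb_or yM andbT.
by rewrite -[X in _ != X](tpermR i j) (inj_eq perm_inj).
Qed.

(** The moves made when a hole walks from k along the points of p. *)
Definition route k p := zip (k :: p) p.

(** Each step of a walk overwrites only the current position of the hole. *)
Lemma hole_route k x p y : hole (route k (x :: p)) y = (y == k).
Proof.
elim: p k x y => [|x' p IH] k x y; first by rewrite /= orbF.
rewrite -[LHS]/((y == k) || hole (route x (x' :: p)) (tperm k x y)) IH.
by rewrite (canF_eq (tpermK k x)) tpermR orbb.
Qed.

Definition ceq u v := forall f g, crel u f g <-> crel v f g.

Lemma ceq_cat u u' v v' : ceq u u' -> ceq v v' -> ceq (u ++ v) (u' ++ v').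
Proof.
move=> uu' vv' f g; rewrite !crel_cat.
by split=> -[h /uu' ? /vv' ?]; exists h.
Qed.

Lemma ceq_sym u v : ceq u v -> ceq v u.
Proof. by move=> uv f g; split=> /uv. Qed.
Lemma ceq_trans u v w : ceq u v -> ceq v w -> ceq u w.
Proof. by move=> uv vw f g; split=> [/uv/vw|/vw/uv]. Qed.

Lemma ceq_moves M N : hole M =1 hole N ->
  (forall x, ~~ hole M x -> move_perm M x = move_perm N x) ->
  ceq (moves M) (moves N).
Proof.
move=> hMN sMN f g; rewrite !crel_moves.
by split=> fg x xh; [rewrite -sMN ?hMN // | rewrite sMN //]; apply: fg;
  rewrite ?hMN // -hMN.
Qed.

Lemma ceq_ee i r : ceq (e_ i ++ e_ i ++ r) (e_ i ++ r).
Proof.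
move=> f g; rewrite crel_ecat; split=> [[h fh /crel_ecat[h' hh' hg]]|[h fh hg]].
  by exists h' => // x xi; rewrite fh // hh'.
by exists f => //; apply/crel_ecat; exists h.
Qed.

Lemma rel_R_sound u v : rel_R u v -> ceq u v.
Proof.
case=> {u v}.
- by move=> i; have := ceq_ee i [::]; rewrite cats0.
- have half i j f g : i != j -> crel (e_ i ++ e_ j) f g -> crel (e_ j ++ e_ i) f g.
    move=> ij [h fh /crel_e hg].
    exists [ffun x => if x == j then g x else f x].
      by move=> x /negbTE xj; rewrite ffunE xj.
    apply/crel_e => x xi; rewrite ffunE; case: eqVneq => // xj.
    by rewrite fh // hg.
  by move=> i j ij f g; split; apply: half; rewrite // eq_sym.
- by move=> i j ij f g; rewrite !(crel_tcat, crel_t); split=> [[]|[? ?]].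
- by move=> i j k l _ _ f g; rewrite !(crel_tcat, crel_t); split=> -[? [? ?]].
- move=> i j k _ f g; rewrite !(crel_tcat, crel_t).
  split=> -[E [? E']]; split=> //; first by split; rewrite // -E' -E.
  by rewrite -E' -E.
- move=> i j k ij; rewrite !inE negb_or => /andP[ki kj] f g.
  rewrite crel_tcat crel_ecat; split=> [[fij fg]|[h fh /crel_t[hg hij]]].
    exists g; first exact/crel_e.
    by apply/crel_t; split=> //; move/crel_e: fg => fg; rewrite -!fg // eq_sym.
  rewrite !fh 1?eq_sym //; split=> //; apply/crel_e.
  by rewrite -hg.
- move=> i j k ij kij f g; rewrite !(crel_tcat, crel_t) crel_ecat.
  split=> [[fij [h fh /crel_t[hg hij]]]|[fg fij]].
    split=> //; rewrite -hg; apply/ffunP=> x; have [xk|/fh//] := eqVneq x k.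
    case/set2P: kij fh xk => -> fh ->; first by rewrite hij -fh ?fij // eq_sym.
    by rewrite -hij -fh.
  by split=> //; exists f => //; apply/crel_t; rewrite -fg.
- move=> i j k ij kij f g; rewrite crel_ecat crel_e.
  split=> [[h fh /crel_tcat[hij /crel_e hg]] x xk|fg]; first by rewrite fh // hg.
  pose m := if k == i then j else i.
  have mk : m != k.
    by rewrite /m; case: (eqVneq k i) => [->|]; rewrite eq_sym.
  exists [ffun x => if x == k then f m else f x].
    by move=> x /negbTE xk; rewrite ffunE xk.
  apply/crel_tcat; split; last first.
    by apply/crel_e => x xk; rewrite ffunE (negbTE xk) fg.
  rewrite !ffunE /m; case/set2P: kij => ->;
  by rewrite !eqxx ?(eq_sym j) (negbTE ij).
(* Both sides of (R9), and of (R10), are closed walks of a hole from k, so that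
   only the two permutations have to be compared. *)
- move=> i j k; rewrite /= !inE negb_or andbT => /andP[/andP[ij ik] jk].
  have D := (negbTE ij, negbTE ik, negbTE jk,
    eq_sym j i, eq_sym k i, eq_sym k j, eqxx).
  have E a b c : ceq (e_ a ++ t_ a b ++ e_ b ++ t_ b c ++ e_ c ++ t_ c a ++ e_ a)
      (moves (route a [:: b; c; a])).
    rewrite -[moves _]/(z_ a b ++ z_ b c ++ z_ c a ++ [::]) !zE.
    apply: ceq_sym; do 2!(apply: ceq_cat => //); apply: ceq_trans (ceq_ee _ _) _.
    by do 2!(apply: ceq_cat => //); apply: ceq_trans (ceq_ee _ _) _.
  apply: ceq_trans (E _ _ _) (ceq_trans _ (ceq_sym (E _ _ _))).
  apply: ceq_moves => [x|x _]; first by rewrite !hole_route.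
  rewrite /= !permM !perm1 !permE /=.
  have [xk|/negbTE xk] := eqVneq x k; first by do 4!rewrite ?xk ?D /=.
  have [xi|/negbTE xi] := eqVneq x i; first by do 4!rewrite ?xi ?D /=.
  have [xj|/negbTE xj] := eqVneq x j; first by do 4!rewrite ?xj ?D /=.
  by do 4!rewrite ?xi ?xj ?xk /=.
- move=> i j k l; rewrite /= !inE !negb_or -!andbA andbT.
  case/and5P=> ij ik il jk /andP[jl kl].
  have D := (negbTE ij, negbTE ik, negbTE il, negbTE jk, negbTE jl, negbTE kl,
    eq_sym j i, eq_sym k i, eq_sym l i, eq_sym k j, eq_sym l j, eq_sym l k, eqxx).
  have E a b c d : ceq (e_ a ++ t_ a b ++ e_ b ++ t_ b c ++ e_ c ++ t_ c d
      ++ e_ d ++ t_ d a ++ e_ a) (moves (route a [:: b; c; d; a])).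
    rewrite -[moves _]/(z_ a b ++ z_ b c ++ z_ c d ++ z_ d a ++ [::]) !zE.
    apply: ceq_sym; do 3!(do 2!(apply: ceq_cat => //);
      apply: ceq_trans (ceq_ee _ _) _).
    done.
  apply: ceq_trans (E _ _ _ _) (ceq_trans _ (ceq_sym (E _ _ _ _))).
  apply: ceq_moves => [x|x _]; first by rewrite !hole_route.
  rewrite /= !permM !perm1 !permE /=.
  have [xk|/negbTE xk] := eqVneq x k; first by do 5!rewrite ?xk ?D /=.
  have [xi|/negbTE xi] := eqVneq x i; first by do 5!rewrite ?xi ?D /=.
  have [xj|/negbTE xj] := eqVneq x j; first by do 5!rewrite ?xj ?D /=.
  have [xl|/negbTE xl] := eqVneq x l; first by do 5!rewrite ?xl ?D /=.
  by do 5!rewrite ?xi ?xj ?xk ?xl /=.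
Qed.

Lemma sim_sound u v : sim u v -> ceq u v.
Proof.
elim=> {u v} [u v|u|u v _ /ceq_sym//|u v w _ uv _|w u v _ uv|w u v _ uv] //.
- exact: rel_R_sound.
- exact: ceq_trans.
- exact: ceq_cat.
- exact: ceq_cat.
Qed.

Lemma eqv_sound u v : u ~= v -> ceq u v.
Proof. by case=> [->//|/sim_sound]. Qed.

End Semantics.

(** * Products of moves with the same image are congruent *)

Section Moves.
Variable n : nat.
Implicit Types (u v w r : word n) (i j k l x y a b c : 'I_n).
Implicit Types (f g h : {ffun 'I_n -> bool}).
Implicit Types (M N L : seq ('I_n * 'I_n)).
Local Open Scope group_scope.

Lemma move_perm_cons i j M x :
  move_perm ((i, j) :: M) x = move_perm M (tperm i j x).
Proof. by rewrite /= permM. Qed.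

(** An erasure can be traced back to the position where the token started. *)
Lemma moves_e M x r :
  moves M ++ e_ (move_perm M x) ++ r ~= e_ x ++ moves M ++ r.
Proof.
elim: M x r => [|[i j] M IH] x r; first by rewrite perm1.
by rewrite !moves_cons move_perm_cons IH zeC.
Qed.

Lemma e_moves M x r : hole M x -> e_ x ++ moves M ++ r ~= moves M ++ r.
Proof.
elim: M x r => [|[i j] M IH] x r //; rewrite !moves_cons.
case/orP=> [/eqP->|/IH E]; first by rewrite ez.
by rewrite -zeC E.
Qed.

Lemma moves_e_hole M y r : (forall x, ~~ hole M x -> move_perm M x != y) ->
  moves M ++ e_ y ++ r ~= moves M ++ r.
Proof.
move=> My; rewrite -{1}(permKV (move_perm M) y) moves_e e_moves //.
by apply: contraT => /My; rewrite permKV eqxx.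
Qed.

Definition e_word (s : seq 'I_n) : word n := flatten [seq e_ x | x <- s].

Lemma e_word_cons x s r : e_word (x :: s) ++ r = e_ x ++ e_word s ++ r.
Proof. by rewrite -catA. Qed.

Lemma e_word_e s x r : x \in s -> e_word s ++ e_ x ++ r ~= e_word s ++ r.
Proof.
have esC y q : e_word s ++ e_ y ++ q ~= e_ y ++ e_word s ++ q.
  by elim: s => [|z s IH] //; rewrite !e_word_cons IH eeC.
rewrite {}esC; elim: s => // z s IH; rewrite inE => /predU1P[->|/IH E].
  by rewrite e_word_cons ee.
by rewrite e_word_cons eeC E.
Qed.

Lemma e_word_moves M s r : (forall x, x \in s -> hole M x) ->
  e_word s ++ moves M ++ r ~= moves M ++ r.
Proof.
elim: s => // x s IH sM; rewrite e_word_cons IH ?e_moves ?sM ?mem_head // => y ys.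
by apply: sM; rewrite inE ys orbT.
Qed.

Lemma e_word_z s x y r : x \in s -> y \in s ->
  e_word s ++ z_ x y ++ r ~= e_word s ++ r.
Proof.
move=> xs ys; rewrite -(e_word_e _ ys) -[X in X ~= _](e_word_e _ xs) eez.
by rewrite (e_word_e _ xs) (e_word_e _ ys).
Qed.

Lemma z_es i j s r :
  z_ i j ++ e_word (map (tperm i j) s) ++ r ~= e_word s ++ z_ i j ++ r.
Proof.
elim: s r => [|x s IH] r //; rewrite !e_word_cons zeC.
by rewrite IH.
Qed.

(** The word of the moves of a hole that walks from k along p; the final
letter gives the walk without steps the meaning of a hole at k. *)
Fixpoint walk k p : word n := if p is x :: p' then z_ k x ++ walk x p' else e_ k.

Lemma walk_cons k x p : walk k (x :: p) = z_ k x ++ walk x p.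
Proof. by []. Qed.

Lemma e_walk k p : e_ k ++ walk k p ~= walk k p.
Proof.
case: p => [|x p]; last by rewrite walk_cons ez.
by have := ee k [::]; rewrite cats0.
Qed.

(** All the holes but one can be kept aside in [s].  After each move the hole
is led to the one where the walk for the remaining moves starts: going from one
hole to another does nothing. *)
Lemma moves_walk M s : M != [::] -> (forall x, hole M x -> x \in s) ->
  exists2 k, hole M k & exists p, e_word s ++ moves M ~= e_word s ++ walk k p.
Proof.
elim: M s => [|[i j] M IH] s // _ Ms.
have ih M1 : hole ((i, j) :: M1) i by rewrite /= eqxx.
have [->|M0] := eqVneq M [::].
  exists i => //; exists [:: j].
  by rewrite walk_cons -[moves _]/(z_ i j ++ [::]) -ze.
have [|k kM [p E]] := IH (map (tperm i j) s) M0.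
  move=> x Mx; rewrite -(tpermK i j x) map_f // Ms //= tpermK Mx.
  by rewrite orbT.
exists i => //; exists (j :: k :: p).
rewrite -[moves _]/(z_ i j ++ moves M) -z_es E z_es !walk_cons.
have cs : tperm i j k \in s by apply: Ms; rewrite /= tpermK kM orbT.
rewrite -[X in _ ~= X](e_word_e _ cs) -zeC tpermK -(ez j k) (eeC k j) eez e_walk.
by rewrite ze.
Qed.

(** Inserting a return to k after each step turns a walk into loops based at
k. *)
Lemma walk_loops k x p :
  exists L, z_ k x ++ walk x p ~= e_ k ++ taus k L ++ z_ k (last x p).
Proof.
elim: p x => [|y p IH] x.
  exists [::]; have := ez k x [::]; have := ze k x [::]; rewrite !cats0.
  by move=> -> E; symmetry.
have [L E] := IH y; exists ((x, y) :: L).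
by rewrite walk_cons taus_cons -catA etau -taue -E tauE zzK e_walk.
Qed.

(** A partial permutation is determined by its relation: a colouring can change
freely at an upper point exactly when that point is a hole. *)
Lemma partial_inj (A B : pred 'I_n) (s t : {perm 'I_n}) :
  (forall f g, (forall x, ~~ A x -> g (s x) = f x) <->
               (forall x, ~~ B x -> g (t x) = f x)) ->
  A =1 B /\ forall x, ~~ A x -> s x = t x.
Proof.
move=> AB.
have half (A' B' : pred 'I_n) (s' t' : {perm 'I_n}) x :
    (forall f g, (forall x, ~~ A' x -> g (s' x) = f x) ->
                 (forall x, ~~ B' x -> g (t' x) = f x)) -> A' x -> B' x.
  move=> AB' A'x; apply: contraT => B'x.
  have H : true = false; last by [].
  have := AB' [ffun y => y != x] [ffun=> true].
  move/(_ _ x B'x); rewrite !ffunE eqxx; apply=> y A'y; rewrite !ffunE.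
  by case: eqVneq A'y => // ->; rewrite A'x.
have eAB : A =1 B.
  by move=> x; apply/idP/idP; [apply: (half _ _ s t) | apply: (half _ _ t s)]
    => f g /AB.
split=> // x Ax; have Bx : ~~ B x by rewrite -eAB.
have [/(_ _ x Bx)H _] := AB [ffun y => s y == s x] [ffun y => y == s x].
by move: H; rewrite !ffunE eqxx => H; apply/esym/eqP/H => y _; rewrite !ffunE.
Qed.

Lemma move_perm_fix M p : (forall ij, ij \in M -> ij.1 != p /\ ij.2 != p) ->
  move_perm M p = p.
Proof.
elim: M => [|[i j] M IH] Mp; first by rewrite perm1.
have [/= ip jp] := Mp (i, j) (mem_head _ _).
rewrite move_perm_cons tpermD // IH // => ij ijM.
by apply: Mp; rewrite inE ijM orbT.
Qed.

Lemma move_perm_cat M N x : move_perm (M ++ N) x = move_perm N (move_perm M x).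
Proof.
elim: M x => [|[i j] M IH] x; first by rewrite perm1.
by rewrite cat_cons !move_perm_cons IH.
Qed.

Lemma loops_avoid k p (S : pred 'I_n) L : p != k ->
  within (fun x => S x && (x != p)) L ->
  forall ij, ij \in loops k L -> ij.1 != p /\ ij.2 != p.
Proof.
move=> pk; elim: L => // -[x y] L IH; rewrite /= -/(within _ L) -!andbA.
case/and5P=> _ xp _ yp /IH{}IH ij; rewrite /loops /= !inE.
by rewrite eq_sym in pk; case/or4P=> [/eqP->|/eqP->|/eqP->|/IH].
Qed.

(** The image of u is the identity restricted to the complement of A. *)
Definition fixes (A : pred 'I_n) u : Prop :=
  forall f g, crel u f g <-> forall x, ~~ A x -> g x = f x.

#[local] Instance fixes_eqv A : Proper (@eqv n ==> iff) (fixes A).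
Proof. by move=> u v /eqv_sound uv; split=> Au f g; rewrite -Au uv. Qed.

Lemma fixes_moves A M : fixes A (moves M) ->
  hole M =1 A /\ forall x, ~~ A x -> move_perm M x = x.
Proof.
move=> AM; have [|MA Mx] := @partial_inj (hole M) A (move_perm M) 1.
  move=> f g; rewrite -crel_moves AM.
  by split=> H x /H; rewrite perm1.
by split=> // x; rewrite -MA => /Mx; rewrite perm1.
Qed.

Lemma e_word_movesE s r : e_word s ++ r ~= moves [seq (x, x) | x <- s] ++ r.
Proof.
elim: s => // x s IH.
by rewrite e_word_cons -[map _ (x :: s)]/((x, x) :: map _ s) moves_cons IH zxx.
Qed.

(** The symmetric group argument.  A point p outside A is fixed by the image, so
that after [taus_elim] the only transposition that may move p must be trivial;
once all these points are gone, the remaining loops run through holes. *)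
Lemma taus_trivial (A : pred 'I_n) k l L s : s =i A -> A k ->
  fixes A (e_word s ++ e_ k ++ taus k L ++ z_ k l) -> 
  e_word s ++ e_ k ++ taus k L ++ z_ k l ~= e_word s.
Proof.
move=> sA Ak AL.
(* The colour of the lower point l is unconstrained, hence l is a hole. *)
have Al : A l.
  apply: contraT => nAl; pose c : {ffun 'I_n -> bool} := [ffun=> true].
  have E : e_word s ++ e_ k ++ taus k L ++ z_ k l
      = (e_word s ++ e_ k ++ taus k L) ++ z_ k l by rewrite -!catA.
  have : crel (e_word s ++ e_ k ++ taus k L ++ z_ k l) c c by apply/AL.
  rewrite E => /crel_cat[h ch /crel_z hc].
  suff /AL/(_ l nAl) : crel (e_word s ++ e_ k ++ taus k L ++ z_ k l) c
      [ffun y => y != l] by rewrite !ffunE eqxx.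
  rewrite E; apply/crel_cat; exists h => //; apply/crel_z => x xk.
  by rewrite -hc // !ffunE (canF_eq (tpermK k l)) tpermR.
pose ps := enum 'I_n.
have : within (fun x => (x \in ps) || A x) L.
  by apply/allP => -[x y] _; rewrite /= !mem_enum.
elim: ps L AL => [|p ps IH] L AL wL.
  have E r : e_word s ++ taus k L ++ r ~= e_word s ++ r.
    elim: L wL r {AL} => // -[x y] L IH /andP[/andP[Ax Ay] wL] r.
    by rewrite taus_cons -catA tauE !e_word_z ?sA // IH.
  by rewrite e_word_e ?sA // E -[z_ _ _]cats0 e_word_z ?sA // cats0.
have [Ap|nAp] := boolP (A p).
  apply: IH => //; apply: sub_all wL => -[x y] /=; rewrite !inE.
  have H z : [|| z == p, z \in ps | A z] = (z \in ps) || A z.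
    by case: eqVneq => // ->; rewrite Ap orbT.
  by rewrite -!orbA !H.
have pk : p != k by apply: contraNneq nAp => ->.
have [L' wL' E] := taus_elim pk wL.
have wL'' : within (fun x => (x \in ps) || A x) L'.
  apply: sub_all wL' => -[x y] /=; rewrite !inE -!andbA.
  by case: (x == p) (y == p) => [] [] /=; rewrite ?andbF ?andbT //= => /andP[-> ->].
case: E => [E|[a [Sa ap ak E]]].
  have E' : e_ k ++ taus k L ++ z_ k l ~= e_ k ++ taus k L' ++ z_ k l.
    by rewrite catA E -(catA (e_ k)).
  by rewrite E' in AL *; apply: IH.
have E' : e_ k ++ taus k L ++ z_ k l ~= tau k p a ++ taus k L' ++ z_ k l.
  by rewrite catA E -(catA (tau k p a)).
rewrite E' e_word_movesE in AL.
have zE1 : z_ k l = moves [:: (k, l)] by rewrite -[RHS]/(z_ k l ++ [::]) cats0.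
rewrite zE1 /tau /taus -!moves_cat in AL.
(* The image sends p to a, and what follows avoids p: this contradicts that p
   is fixed. *)
have [_ /(_ p nAp)] := fixes_moves AL; rewrite !move_perm_cat.
have -> : move_perm [seq (x, x) | x <- s] p = p.
  by elim: (s) => [|x s' IHs]; rewrite ?perm1 // move_perm_cons tperm1 perm1.
rewrite !move_perm_cons tpermR (tpermD pk ak) tpermR perm1.
rewrite -{1}(@move_perm_fix (loops k L' ++ [:: (k, l)]) p) => [|ij].
  rewrite move_perm_cat move_perm_cons !perm1 => /perm_inj/perm_inj/eqP.
  by rewrite (negbTE ap).
rewrite mem_cat inE => /orP[/(loops_avoid pk wL')//|/eqP->] /=.
by rewrite eq_sym; split=> //; apply: contraNneq nAp => <-.
Qed.

Lemma moves_idem A M : M != [::] -> fixes A (moves M) ->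
  moves M ~= e_word (enum A).
Proof.
move=> M0 AM; have [MA _] := fixes_moves AM.
have sA : enum A =i A by move=> x; rewrite mem_enum.
have [|k Mk [p E]] := moves_walk (s := enum A) M0.
  by move=> x; rewrite MA mem_enum.
have {E}E : moves M ~= e_word (enum A) ++ walk k p.
  rewrite -E -[X in _ ++ X]cats0 e_word_moves ?cats0 // => x.
  by rewrite mem_enum MA.
have [L EL] := walk_loops k k p.
rewrite -e_walk -zxx {}EL in E.
by rewrite E in AM *; apply: taus_trivial AM; rewrite // -MA.
Qed.

Definition reverse_moves M := rev [seq (ij.2, ij.1) | ij <- M].

Lemma reverse_moves_cons i j M r : moves (reverse_moves ((i, j) :: M)) ++ r
  = moves (reverse_moves M) ++ z_ j i ++ r.
Proof.
by rewrite /reverse_moves /= rev_cons -cats1 moves_cat -catA moves_cons.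
Qed.

Lemma crel_reverse_moves M f g :
  crel (moves (reverse_moves M)) f g <-> crel (moves M) g f.
Proof.
have Rel_zC i j f' g' : crel (z_ i j) f' g' -> crel (z_ j i) g' f'.
  move=> /crel_z fg; apply/crel_z => x xj; rewrite tpermC -fg ?tpermK //.
  by rewrite (canF_eq (tpermK i j)) tpermL.
elim: M f g => [|[i j] M IH] f g; first by split=> /= ->.
rewrite -[moves (reverse_moves _)]cats0 reverse_moves_cons cats0.
rewrite -[moves (_ :: _)]/(z_ i j ++ moves M) !crel_cat.
by split=> -[h]; [move=> /IH ? /Rel_zC | move=> /Rel_zC ? /IH]; exists h.
Qed.

(** Undoing moves before making them is harmless after a word u that has
already emptied the positions which these moves overwrite. *)
Lemma reverse_movesK u M r :
  (forall y q, (forall x, ~~ hole M x -> move_perm M x != y) ->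
     u ++ e_ y ++ q ~= u ++ q) ->
  u ++ moves (reverse_moves M) ++ moves M ++ r ~= u ++ r.
Proof.
elim: M r => [|[i j] M IH] r // uM.
rewrite reverse_moves_cons moves_cons zzK -moves_e IH ?uM // => [x|y q yM].
  rewrite /= negb_or permM => /andP[xi _]; rewrite (inj_eq perm_inj).
  by rewrite (canF_eq (tpermK i j)) tpermR.
apply: uM => x; rewrite /= negb_or permM => /andP[_]; exact: yM.
Qed.

(** With N^-1 the reverse of N, the word M N^-1 is idempotent because M and N have
the same image, so M ~ M N^-1 N ~ e_A N ~ N where A is the common set of
holes. *)
Theorem moves_complete M N : M != [::] -> N != [::] ->
  ceq (moves M) (moves N) -> moves M ~= moves N.
Proof.
move=> M0 N0 MN.
have [|eA e_word] := @partial_inj (hole M) (hole N) (move_perm M) (move_perm N).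
  by move=> f g; rewrite -!crel_moves.
rewrite -[moves M]cats0 -(@reverse_movesK _ N).
  rewrite cats0 catA -moves_cat (@moves_idem (hole M)).
  - by rewrite -[moves N]cats0 e_word_moves // => x; rewrite mem_enum -eA.
  - by case: (M) M0.
  move=> f g; rewrite moves_cat crel_cat; split=> [[h Mh]|fg].
    move/crel_reverse_moves=> /crel_moves gh x xM; move/crel_moves: Mh => fh.
    by rewrite -gh -?eA // -e_word // fh.
  exists [ffun y => f ((move_perm M)^-1 y)].
    by apply/crel_moves => x _; rewrite ffunE permK.
  apply/crel_reverse_moves/crel_moves => x; rewrite -eA => xM.
  by rewrite -e_word // ffunE permK fg.
move=> y q yN; rewrite moves_e_hole // => x xM.
by rewrite e_word // yN // -eA.
Qed.

End Moves.

(** * Faithfulness of the representation *)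

Section Faithful.
Variable n : nat.
Implicit Types (w : word n) (i j x y : 'I_n) (f g h : {ffun 'I_n -> bool}).
Implicit Types (al be : ptn n) (u v : vertex n).

Definition linked al : rel (vertex n) := fun u v =>
  [exists X in blocks al, (u \in X) && (v \in X)].

Lemma linkedE al u v : linked al u v = (v \in pblock al u).
Proof.
have /and3P[/eqP cov tI _] := blocksP al.
have ual : pblock al u \in blocks al by rewrite pblock_mem // cov inE.
apply/existsP/idP => [[X /and3P[Xal uX vX]]|vu].
  by rewrite (def_pblock tI Xal uX).
by exists (pblock al u); rewrite ual vu mem_pblock cov inE.
Qed.

Lemma linked_refl al u : linked al u u.
Proof.
have /and3P[/eqP cov _ _] := blocksP al.
by rewrite linkedE mem_pblock cov inE.
Qed.

Lemma linked_sym al : symmetric (linked al).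
Proof. by move=> u v; apply: eq_existsb => X; congr (_ && _); rewrite andbC. Qed.

Lemma linked_trans al : transitive (linked al).
Proof.
have /and3P[/eqP cov tI _] := blocksP al => v u w.
by rewrite !linkedE => /(same_pblock tI)->.
Qed.

Lemma linked_mul al be u v : linked (ptn_mul al be) u v = prod_rel al be u v.
Proof.
by rewrite linkedE pblock_equivalence_partition ?inE //; exact: prod_rel_equiv.
Qed.

Definition join f g u : bool := match u with inl x => f x | inr y => g y end.

Definition compat al f g :=
  forall u v, linked al u v -> join f g u = join f g v.

Lemma prod_edge_left al be u v :
  linked al u v -> prod_edge al be (inl u) (inl v).
Proof.
case/existsP=> X /and3P[Xal uX vX]; apply/orP; left; apply/existsP; exists X.
by rewrite Xal /= !imset_f.
Qed.

Lemma prod_edge_right al be u v :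
  linked be u v -> prod_edge al be (emb_right u) (emb_right v).
Proof.
case/existsP=> X /and3P[Xal uX vX]; apply/orP; right; apply/existsP; exists X.
by rewrite Xal /= !imset_f.
Qed.

(** A compatible pair of colourings of the outer points extends to the middle
points: colour a middle point by the outer points connected to it, if any. *)
Lemma compat_mul al be f g :
  compat (ptn_mul al be) f g <-> exists2 h, compat al f h & compat be h g.
Proof.
split=> [fg|[h fh hg] u v].
  pose c N := [exists u, connect (prod_edge al be) (emb_outer u) N && join f g u].
  have c_edge N N' : prod_edge al be N N' -> c N = c N'.
    move=> NN'; apply: eq_existsb => u; congr (_ && _).
    apply: (same_connect_r _ (connect1 NN')).
    exact: sym_connect_sym (@prod_edge_sym _ _ _).
  have c_outer u : c (emb_outer u) = join f g u.
    apply/existsP/idP => [[v /andP[vu]]|gu]; last by exists u; rewrite connect0.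
    by rewrite (fg v u) // linked_mul.
  have c_upper x : c (inl (inl x)) = f x := c_outer (inl x).
  have c_lower y : c (inr y) = g y := c_outer (inr y).
  exists [ffun y => c (inl (inr y))] => u v.
    move/(prod_edge_left be)/c_edge.
    by case: u v => [x|x] [y|y]; rewrite /= ?ffunE ?c_upper.
  move/(prod_edge_right al)/c_edge.
  by case: u v => [x|x] [y|y]; rewrite /= ?ffunE ?c_lower.
rewrite linked_mul => /connectP[p].
pose c (N : vertex n + 'I_n) := match N with inl u => join f h u | inr y => g y end.
have cR u' : c (emb_right u') = join h g u' by case: u'.
have cO u' : c (emb_outer u') = join f g u' by case: u'.
rewrite -!cO; elim: p (emb_outer u) => [|N p IH] N0 /=; first by move=> _ ->.
case/andP=> e pN /(IH _ pN) <-; case/orP: e => /existsP[X /and3P[XP]].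
  case/imsetP=> u1 u1X -> /imsetP[v1 v1X ->]; apply: fh.
  by apply/existsP; exists X; rewrite XP u1X.
case/imsetP=> u1 u1X -> /imsetP[v1 v1X ->]; rewrite !cR; apply: hg.
by apply/existsP; exists X; rewrite XP u1X.
Qed.

Lemma compat_one f g : compat (ptn_one n) f g <-> f = g.
Proof.
split=> [fg|-> u v /existsP[X /andP[/imsetP[x _ ->]]]].
  apply/ffunP=> x; apply: (fg (inl x) (inr x)); apply/existsP.
  exists [set inl x; inr x]; rewrite set21 set22 !andbT.
  exact: imset_f.
by rewrite !inE => /andP[/orP[]/eqP-> /orP[]/eqP->].
Qed.

Lemma compat_e i f g : compat (ptn_e i) f g <-> forall x, x != i -> f x = g x.
Proof.
split=> [fg x xi|fg u v /existsP[X /andP[]]].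
  apply: (fg (inl x) (inr x)); apply/existsP.
  exists [set inl x; inr x]; rewrite !inE !eqxx /= andbT; apply/orP; right.
  by apply: imset_f; rewrite inE.
case/setUP=> [/set2P[]->|/imsetP[x xi ->]]; first by case/andP=> /set1P-> /set1P->.
  by case/andP=> /set1P-> /set1P->.
by rewrite inE in xi; rewrite !inE => /andP[/orP[]/eqP-> /orP[]/eqP->] //=; rewrite fg.
Qed.

Lemma compat_t i j f g : compat (ptn_t i j) f g <-> f = g /\ f i = f j.
Proof.
split=> [fg|[<- fij] u v /existsP[X /andP[]]].
  have E u v : u \in [set inl i; inl j; inr i; inr j] ->
      v \in [set inl i; inl j; inr i; inr j] -> join f g u = join f g v.
    move=> uX vX; apply: fg; apply/existsP.
    by exists [set inl i; inl j; inr i; inr j]; rewrite uX vX setU11.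
  split; last by apply: (E (inl i) (inl j)); rewrite !inE !eqxx ?orbT.
  apply/ffunP=> x; have [/set2P xij|xij] := boolP (x \in [set i; j]).
    by apply: (E (inl x) (inr x)); case: xij => ->; rewrite !inE !eqxx ?orbT.
  apply: (fg (inl x) (inr x)); apply/existsP.
  exists [set inl x; inr x]; rewrite !inE !eqxx /= andbT; apply/orP; right.
  by apply: imset_f; rewrite inE.
case/setU1P=> [->|/imsetP[x _ ->]]; last first.
  by rewrite !inE => /andP[/orP[]/eqP-> /orP[]/eqP->].
suff H u' : u' \in [set inl i; inl j; inr i; inr j] -> join f f u' = f i.
  by case/andP=> /H-> /H->.
by rewrite !inE -!orbA => /or4P[]/eqP->.
Qed.

Lemma crel_phi w f g : crel w f g <-> compat (phi w) f g.
Proof.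
elim: w f => [|a w IH] f; first by rewrite compat_one.
rewrite [phi _]/= compat_mul.
by split=> -[h fh /IH hg]; exists h => //; move: fh; case: a => [i|ij] /=;
  rewrite ?compat_e ?compat_t.
Qed.

Lemma linked_phi w u v :
  linked (phi w) u v <-> forall f g, crel w f g -> join f g u = join f g v.
Proof.
split=> [uv f g /crel_phi|H]; first exact.
pose f := [ffun x => linked (phi w) u (inl x)].
pose g := [ffun x => linked (phi w) u (inr x)].
have E v' : join f g v' = linked (phi w) u v' by case: v' => x; rewrite /= ffunE.
rewrite -E -H ?E ?linked_refl //; apply/crel_phi => u' v' uv'; rewrite !E.
apply/idP/idP => h; apply: linked_trans h _ => //.
by rewrite linked_sym.
Qed.

End Faithful.

(** * Absorption and factorisation *)

Section Factorisation.
Variable n : nat.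
Implicit Types (u v w r : word n) (i j k l x y a b c : 'I_n).
Implicit Types (f g h : {ffun 'I_n -> bool}).
Implicit Types (M N L P Q : seq ('I_n * 'I_n)).
Local Open Scope group_scope.

Definition absorbs w x y := t_ x y ++ w ~= w.

Lemma absorbs_trans w x y a : absorbs w x y -> absorbs w y a -> absorbs w x a.
Proof.
rewrite /absorbs => xy ya; rewrite -[X in X ~= _]/(t_ x a ++ w) -xy -ya.
by rewrite tt_tri ttC (t_sym x a) ttK.
Qed.

(** By induction on w, reading the kernel of a word off its first letter: e_i
isolates i, and t_ij joins the classes of i and j. *)
Lemma t_kernel w x y : linked (phi w) (inl x) (inl y) -> t_ x y ++ w ~= w.
Proof.
have [->|xy] := eqVneq x y; first by rewrite t_refl.
elim: w x y xy => [|a w IH] x y xy.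
  move/linked_phi/(_ [ffun z => z == x] [ffun z => z == x] (erefl _)).
  by rewrite /= !ffunE eqxx (eq_sym y) (negbTE xy).
case: a => [i|[[i j] ij]].
  rewrite -[LE i :: w]/(e_ i ++ w) => /linked_phi H.
  (* The colour of i is unconstrained, so that i is alone in its class. *)
  have flip z : (forall f g, crel (e_ i ++ w) f g -> f i = f z) -> z = i.
    move=> Hz; apply: contraTeq isT => zi.
    pose c : {ffun 'I_n -> bool} := [ffun => true].
    have cc : crel (e_ i ++ w) c c.
      by apply/crel_phi => u v _; case: u v => [?|?] [?|?]; rewrite /= !ffunE.
    have /Hz : crel (e_ i ++ w) [ffun z => z != i] c.
      move: cc => /crel_ecat[h ch hc]; apply/crel_ecat; exists h => // z' z'i.
      by rewrite -ch // !ffunE.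
    by rewrite !ffunE eqxx zi.
  have xi : x != i.
    apply: contra_neq xy => xi; symmetry; rewrite xi in H *.
    exact: flip.
  have yi : y != i.
    apply: contra_neq xy => yi; rewrite yi in H *.
    by apply: flip => f g /H.
  rewrite teC 1?eq_sym // IH //; apply/linked_phi => f g fg.
  by apply: (H f g); apply/crel_ecat; exists f.
have -> : LT (exist _ (i, j) ij) :: w = t_ i j ++ w.
  by rewrite /t_ insubT.
move/linked_phi => H.
pose lk x1 y1 := linked (phi w) (inl x1) (inl y1).
(* The class of x for the join of the kernel of w with the pair (i, j). *)
pose near (v : vertex n) := [|| linked (phi w) (inl x) v,
  lk x i && linked (phi w) (inl j) v | lk x j && linked (phi w) (inl i) v].
have : near (inl y).
  have nearP (u v : vertex n) : linked (phi w) u v -> near u = near v.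
    move=> uv; have E z : linked (phi w) z u = linked (phi w) z v.
      apply/idP/idP => h; apply: linked_trans h _ => //.
      by rewrite linked_sym.
    by rewrite /near !E.
  pose f := [ffun x => near (inl x)]; pose g := [ffun x => near (inr x)].
  have E (v : vertex n) : join f g v = near v by case: v => z; rewrite /= ffunE.
  have /H : crel (t_ i j ++ w) f g.
    apply/crel_tcat; split; last by apply/crel_phi => u v; rewrite !E; exact: nearP.
    rewrite !ffunE /near -!/(lk _ _) /lk !linked_refl !andbT.
    by case: (linked _ (inl x) (inl i)); case: (linked _ (inl x) (inl j)).
  by rewrite !E /near linked_refl => <-.
have lkA x1 y1 : lk x1 y1 -> absorbs (t_ i j ++ w) x1 y1.
  have [-> _|xy1] := eqVneq x1 y1; first by rewrite /absorbs t_refl.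
  by rewrite /absorbs ttC => /(IH _ _ xy1)->.
have ijA : absorbs (t_ i j ++ w) i j by rewrite /absorbs ttK.
case/or3P=> [/lkA//|/andP[/lkA xi /lkA jy]|/andP[/lkA xj /lkA iy]].
  exact: absorbs_trans xi (absorbs_trans ijA jy).
have jiA : absorbs (t_ i j ++ w) j i by rewrite /absorbs (t_sym j) ttK.
exact: absorbs_trans xj (absorbs_trans jiA iy).
Qed.

Lemma rev_t i j : rev (t_ i j) = t_ i j.
Proof. by rewrite /t_; case: (insubP _ (i, j)) => // _; case: (insubP _ (j, i)). Qed.

(** The congruence is invariant under reversal of words, which exchanges kernel
and cokernel. *)
Lemma rev_rel_R u v r : rel_R u v -> rev u ++ r ~= rev v ++ r.
Proof.
have rev_e i : rev (e_ i) = e_ i by [].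
have rev_path := (rev_cat, rev_t, rev_e, catA).
case=> {u v}.
- by move=> i; rewrite !rev_path -!catA ee.
- by move=> i j _; rewrite !rev_path -!catA eeC.
- by move=> i j _; rewrite !rev_path -!catA ttK.
- by move=> i j k l _ _; rewrite !rev_path -!catA ttC.
- by move=> i j k _; rewrite !rev_path -!catA ttC tt_tri ttC.
- move=> i j k _; rewrite !inE negb_or => /andP[ki kj].
  by rewrite !rev_path -!catA teC.
- move=> i j k ij kij; rewrite !rev_path -!catA.
  by have := rel_R_eqv r (R7 ij kij); rewrite -!catA.
- move=> i j k ij kij; rewrite !rev_path -!catA.
  by have := rel_R_eqv r (R8 ij kij); rewrite -!catA.
- move=> i j k u; rewrite !rev_path -!catA.
  have := rel_R_eqv r (R9 u); rewrite -!catA => E; symmetry.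
  by rewrite (t_sym i k) (t_sym j i) (t_sym k j) E (t_sym k j) (t_sym j i) (t_sym i k).
- move=> i j k l u; rewrite !rev_path -!catA.
  have u' : uniq [:: j; i; k; l].
    by rewrite (uniq_catCA [:: j] [:: i]).
  have := rel_R_eqv r (R10 u'); rewrite -!catA (t_sym k l) => E; symmetry.
  by rewrite (t_sym j k) (t_sym i j) (t_sym l i) (t_sym j l) (t_sym k i).
Qed.

Lemma eqv_rev u v : u ~= v -> rev u ~= rev v.
Proof.
case=> [->//|]; elim=> {u v} [u v uv|//|u v _ ->//|u v w _ -> _ //|w u v _ E|w u v _ E].
- by have := rev_rel_R [::] uv; rewrite !cats0.
- by rewrite !rev_cat E.
- by rewrite !rev_cat E.
Qed.

Lemma crel_rev w f g : crel (rev w) f g <-> crel w g f.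
Proof.
elim: w f g => [|a w IH] f g; first by split=> /= ->.
have letterC f' g' : letter_rel a f' g' -> letter_rel a g' f'.
  by case: a => [i fg x xi|ij [-> ?]]; [rewrite fg | split].
rewrite rev_cons -cats1 crel_cat; split=> [[h /IH wh [h' /letterC ah <-]]|].
  by exists h.
by case=> h /letterC ah wh; exists h; [apply/IH | exists g].
Qed.

Lemma t_cokernel w x y : linked (phi w) (inr x) (inr y) -> w ++ t_ x y ~= w.
Proof.
move=> /linked_phi wxy; rewrite -[w]revK -(rev_t x y) -rev_cat; apply: eqv_rev.
apply: t_kernel; apply/linked_phi => f g /crel_rev; exact: wxy.
Qed.

Lemma z_t i j x y r : x != i -> y != i ->
  z_ i j ++ t_ (tperm i j x) (tperm i j y) ++ r ~= t_ x y ++ z_ i j ++ r.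
Proof.
move=> xi yi.
have [->|xy] := eqVneq x y; first by rewrite !t_refl.
have [<-|ij] := eqVneq i j.
  by rewrite tperm1 !perm1 !zxx teC 1?eq_sym.
have half a : a != i -> a != j ->
    z_ i j ++ t_ i a ++ r ~= t_ j a ++ z_ i j ++ r.
  move=> ai aj; rewrite !zE -[X in _ ++ _ ++ X]teC 1?eq_sym // (t_sym i j).
  by rewrite -tt_tri (t_sym a j) -teC // eq_sym.
have [xj|xj] := eqVneq x j.
  have yj : y != j by rewrite -xj eq_sym.
  by rewrite xj tpermR tpermD 1?eq_sym // half.
have [yj|yj] := eqVneq y j.
  by rewrite yj tpermR tpermD 1?eq_sym // t_sym half // t_sym.
rewrite !tpermD 1?eq_sym // !zE -[X in _ ++ _ ++ X]teC 1?eq_sym //.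
by rewrite (ttC i j) -teC // eq_sym.
Qed.

(** A token carries its merges along; when it is the token that moves, this is
(R5). *)
Lemma moves_t M x y r : ~~ hole M x -> ~~ hole M y ->
  moves M ++ t_ (move_perm M x) (move_perm M y) ++ r ~= t_ x y ++ moves M ++ r.
Proof.
elim: M x y r => [|[i j] M IH] x y r; first by rewrite !perm1.
rewrite !move_perm_cons !moves_cons => /norP[xi Mx] /norP[yi My].
by rewrite IH // z_t.
Qed.

Definition t_word P : word n := flatten [seq t_ ij.1 ij.2 | ij <- P].

Lemma t_word_cons i j P r : t_word ((i, j) :: P) ++ r = t_ i j ++ t_word P ++ r.
Proof. by rewrite -catA. Qed.

Lemma t_word_cat P Q : t_word (P ++ Q) = t_word P ++ t_word Q.
Proof. by rewrite /t_word map_cat flatten_cat. Qed.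

Lemma t_word1 i j : t_word [:: (i, j)] = t_ i j.
Proof. by rewrite -[LHS]/(t_ i j ++ [::]) cats0. Qed.

Lemma t_word_t P i j r : t_word P ++ t_ i j ++ r ~= t_ i j ++ t_word P ++ r.
Proof. by elim: P => [|[a b] P IH] //; rewrite !t_word_cons IH ttC. Qed.

(** To erase i after merging: either i was not merged with another point, and
the erasure commutes with the merging, or i can be merged with a single j and
all the other pairs avoid i. *)
Lemma t_word_e Q i :
  (exists Q', forall r, t_word Q ++ e_ i ++ r ~= e_ i ++ t_word Q' ++ r) \/
  exists2 j, j != i & exists Q', forall r,
    t_word Q ++ e_ i ++ r ~= t_ i j ++ e_ i ++ t_word Q' ++ r.
Proof.
elim: Q => [|[a b] Q IH]; first by left; exists [::].
have [ab|ab] := eqVneq a b.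
  by move: IH; rewrite ab; case=> [[Q' E]|[j ji [Q' E]]]; [left | right; exists j];
    rewrite //; exists Q' => r; rewrite t_word_cons t_refl E.
wlog bi : a b ab / b != i.
  move=> H; have [bi|] := eqVneq b i; last exact: H.
  have [ba ai] : b != a /\ a != i by rewrite eq_sym -bi.
  have [[Q' E]|[j ji [Q' E]]] := H b a ba ai; [left | right; exists j => //];
    by exists Q' => r; rewrite t_word_cons t_sym -t_word_cons E.
have [ai|ai] := eqVneq a i; last first.
  case: IH => [[Q' E]|[j ji [Q' E]]].
    left; exists ((a, b) :: Q') => r.
    by rewrite !t_word_cons E teC // eq_sym.
  right; exists j => //; exists ((a, b) :: Q') => r.
  by rewrite !t_word_cons E ttC teC // eq_sym.
rewrite ai in ab *; case: IH => [[Q' E]|[j ji [Q' E]]].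
  by right; exists b => //; exists Q' => r; rewrite !t_word_cons E.
right; exists j => //; exists ((b, j) :: Q') => r.
rewrite !t_word_cons E (t_sym i b) tt_tri (t_sym j b).
by rewrite -[X in _ ~= _ ++ X]teC // eq_sym.
Qed.

Lemma moves_rcons M i j r :
  moves (M ++ [:: (i, j)]) ++ r = moves M ++ z_ i j ++ r.
Proof. by rewrite moves_cat -catA moves_cons. Qed.

Lemma cat1_neq0 M ij : M ++ [:: ij] != [::].
Proof. by case: M. Qed.

(** Merging i with j and then erasing i: if i is a hole nothing happens, if j is
one then the token at i moves to j, and otherwise the merging can be done
before the moves. *)
Lemma moves_t_e M i j : M != [::] -> j != i ->
  exists P, exists2 M', M' != [::] & forall r,
    moves M ++ t_ i j ++ e_ i ++ r ~= t_word P ++ moves M' ++ r.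
Proof.
move=> M0 ji; set x := (move_perm M)^-1 i; set y := (move_perm M)^-1 j.
have hole_e z r : hole M ((move_perm M)^-1 z) ->
    moves M ++ e_ z ++ r ~= moves M ++ r.
  move=> Mz; apply: moves_e_hole => z' Mz'; apply: contraNneq Mz' => E.
  by rewrite -E permK in Mz.
have [Mx|Mx] := boolP (hole M x).
  exists [::], M => // r; rewrite -(hole_e i) // ete 1?eq_sym //.
  by rewrite hole_e.
have [My|My] := boolP (hole M y).
  exists [::], (M ++ [:: (j, i)]) => [|r]; first exact: cat1_neq0.
  by rewrite -(hole_e j) // moves_rcons zE (t_sym j).
exists [:: (x, y)], (M ++ [:: (i, i)]) => [|r]; first exact: cat1_neq0.
rewrite t_word1 moves_rcons zxx -{1}(permKV (move_perm M) i) -/x.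
by rewrite -{1}(permKV (move_perm M) j) -/y moves_t.
Qed.

Lemma letter_t (ij : {ij : 'I_n * 'I_n | ij.1 < ij.2}) :
  [:: LT ij] = t_ (val ij).1 (val ij).2.
Proof. by rewrite /t_ -surjective_pairing valK. Qed.

(** By induction on w; only a final letter e_i needs work, and it is pushed to the
left through the last t letters and then into the moves. *)
Lemma factorisation w : w <> [::] ->
  exists P, exists2 M, M != [::] & exists Q, w ~= t_word P ++ moves M ++ t_word Q.
Proof.
have single (a : letter n) : exists P, exists2 M, M != [::] & exists Q,
    [:: a] ~= t_word P ++ moves M ++ t_word Q.
  case: a => [i|[[i j] ij]].
    exists [::], [:: (i, i)] => //; exists [::].
    by rewrite moves_cons zxx.
  exists [:: (i, j)], [:: (i, i)] => //; exists [:: (i, j)].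
  rewrite letter_t moves_cons zxx !t_word1 -[moves [::] ++ _]/(t_ i j).
  have ij' : i != j by apply: contraTneq ij => /= ->; rewrite ltnn.
  by have := tet [::] ij'; rewrite !cats0 => ->.
elim/last_ind: w => [//|w a IH] _; rewrite -cats1.
case: w IH => [|b w] IH; first exact: single.
have {IH}[//|P [M M0 [Q E]]] := IH.
case: a => [i|ij]; last first.
  exists P, M => //; exists (Q ++ [:: val ij]).
  by rewrite letter_t E t_word_cat -!catA -t_word1 -surjective_pairing.
have {}E : (b :: w) ++ e_ i ~= t_word P ++ moves M ++ t_word Q ++ e_ i ++ [::].
  by rewrite E -!catA.
rewrite -[[:: LE i]]/(e_ i).
have [[Q' EQ]|[j ji [Q' EQ]]] := t_word_e Q i.
  exists P, (M ++ [:: (i, i)]); first exact: cat1_neq0.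
  by exists Q'; rewrite E EQ cats0 moves_rcons zxx.
have [P' [M' M'0 EM]] := moves_t_e M0 ji.
exists (P ++ P'), M' => //; exists Q'.
by rewrite E EQ cats0 EM t_word_cat -catA.
Qed.

Lemma crel_tword P f g : crel (t_word P) f g <->
  f = g /\ forall ij, ij \in P -> f ij.1 = f ij.2.
Proof.
elim: P f => [|[i j] P IH] f; first by split=> [|[]].
rewrite -[t_word _]/(t_ i j ++ t_word P) crel_tcat IH.
split=> [[fij [fg fP]]|[fg fP]].
  by split=> // ij; rewrite inE => /predU1P[->|/fP].
split; first by apply: (fP (i, j)); rewrite mem_head.
by split=> // ij ijP; apply: fP; rewrite inE ijP orbT.
Qed.

Lemma t_word_absorb P w :
  (forall ij, ij \in P -> linked (phi w) (inl ij.1) (inl ij.2)) ->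
  t_word P ++ w ~= w.
Proof.
elim: P => // -[i j] P IH Pw; rewrite t_word_cons IH => [|ij ijP].
  by apply: t_kernel; apply: (Pw (i, j)); rewrite mem_head.
by apply: Pw; rewrite inE ijP orbT.
Qed.

Lemma t_word_absorb_r P w :
  (forall ij, ij \in P -> linked (phi w) (inr ij.1) (inr ij.2)) ->
  w ++ t_word P ~= w.
Proof.
elim/last_ind: P => [|P [i j] IH] Pw; first by rewrite cats0.
rewrite -cats1 t_word_cat t_word1 catA IH => [|ij ijP].
  by apply: t_cokernel; apply: (Pw (i, j)); rewrite mem_rcons mem_head.
by apply: Pw; rewrite mem_rcons inE ijP orbT.
Qed.

Definition generates P (eps : rel 'I_n) :=
  (forall ij, ij \in P -> eps ij.1 ij.2) /\
  (forall f, (forall ij, ij \in P -> f ij.1 = f ij.2) ->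
     forall x y, eps x y -> f x = f y).

Definition is_rep (eps : rel 'I_n) x := [forall y, eps x y ==> (x <= y)].

Lemma rep_exists (eps : rel 'I_n) x : equivalence_rel eps ->
  exists2 m, eps x m & is_rep eps m.
Proof.
move=> eqv_eps; have exx : eps x x by case: (eqv_eps x x x).
case: (arg_minnP (fun y : 'I_n => y : nat) exx) => m xm min_m; exists m => //.
apply/forallP=> y; apply/implyP => my; apply: min_m.
by have [_ ->] := eqv_eps x m y.
Qed.

(** The pairs of consecutive points in each class generate the equivalence. *)
Lemma t_eqv_generates (eps : rel 'I_n) : equivalence_rel eps ->
  exists2 P, t_eqv eps = t_word P & generates P eps.
Proof.
move=> eqv_eps.
pose chain (A : {set 'I_n}) :=
  if enum A is i :: s then pairmap pair i s else [::].
exists (flatten [seq chain [set y | eps x y] | x <- enum 'I_n & is_rep eps x]).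
  rewrite /t_eqv /t_word -/(is_rep eps); elim: [seq x <- _ | _] => //= x s ->.
  rewrite map_cat flatten_cat; congr (_ ++ _); rewrite /t_set /chain.
  case: (enum _) => // i l; elim: l i => //= j l IH i.
  by rewrite IH.
have chainP A ij : ij \in chain A -> ij.1 \in A /\ ij.2 \in A.
  rewrite -!(mem_enum A) /chain; case: (enum A) => // i l.
  elim: l i => //= j l IH i; rewrite inE => /predU1P[-> /=|/IH].
    by rewrite !inE !eqxx orbT.
  by case; rewrite !inE => -> ->; rewrite !orbT.
have chain_const A f x y : (forall ij, ij \in chain A -> f ij.1 = f ij.2) ->
    x \in A -> y \in A -> f x = f y.
  rewrite -!(mem_enum A) /chain; case: (enum A) => // i l H.
  suff E z : z \in i :: l -> f z = f i by move=> /E-> /E->.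
  elim: l i H => [|j l IH] i H /=; first by rewrite inE => /eqP->.
  have fij : f i = f j by apply: (H (i, j)); rewrite mem_head.
  rewrite inE => /predU1P[->//|]; rewrite fij; apply: IH => ij ijl.
  by apply: H; rewrite inE ijl orbT.
split=> [ij /flatten_mapP[x _ /chainP[]]|f fP x y xy].
  by rewrite !inE => xi; have [_ <-] := eqv_eps x ij.1 ij.2.
have [m xm mP] := rep_exists x eqv_eps.
have [_ Em] := eqv_eps x m m; have [_ E] := eqv_eps x m y.
apply: (chain_const [set y | eps m y]) => [ij ijm||].
- apply: fP; apply/flatten_mapP; exists m => //.
  by rewrite mem_filter mP mem_enum.
- by rewrite inE; have [_ <-] := eqv_eps x m x; case: (eqv_eps x x x).
- by rewrite inE -E.
Qed.

Lemma eqv_crel u v f g : u ~= v -> crel u f g -> crel v f g.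
Proof. by move=> /eqv_sound uv /uv. Qed.

Lemma kerE (al : ptn n) x y : ker al x y = linked al (inl x) (inl y).
Proof. by []. Qed.

Lemma cokerE (al : ptn n) x y : coker al x y = linked al (inr x) (inr y).
Proof. by []. Qed.

Lemma linked_equiv (al : ptn n) : equivalence_rel (linked al).
Proof.
move=> u v v'; split=> [|uv]; first exact: linked_refl.
apply/idP/idP; apply: linked_trans => //.
by rewrite linked_sym.
Qed.

Lemma ker_equiv (al : ptn n) : equivalence_rel (ker al).
Proof. by move=> x y z; rewrite !kerE; apply: linked_equiv. Qed.

Lemma coker_equiv (al : ptn n) : equivalence_rel (coker al).
Proof. by move=> x y z; rewrite !cokerE; apply: linked_equiv. Qed.

(** * Moving the transversals to the minima *)

Definition factors w M :=
  M != [::] /\ w ~= t_eqv (ker (phi w)) ++ moves M ++ t_eqv (coker (phi w)).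

Lemma hole_cat M N x : hole (M ++ N) x = hole M x || hole N (move_perm M x).
Proof.
elim: M x => [|[i j] M IH] x; first by rewrite perm1.
by rewrite cat_cons move_perm_cons /= IH orbA.
Qed.

Section Sandwich.

Variable w : word n.
Let T := t_eqv (ker (phi w)).
Let T' := t_eqv (coker (phi w)).

Lemma crel_T f g : crel T f g <->
  f = g /\ forall x y, ker (phi w) x y -> f x = f y.
Proof.
have [P TP [PT fP]] := t_eqv_generates (ker_equiv (phi w)).
rewrite /T TP crel_tword; split=> -[fg H]; split=> //; first exact: fP.
by move=> ij /PT; apply: H.
Qed.

Lemma crel_T' f g : crel T' f g <->
  f = g /\ forall x y, coker (phi w) x y -> f x = f y.
Proof.
have [P TP [PT fP]] := t_eqv_generates (coker_equiv (phi w)).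
rewrite /T' TP crel_tword; split=> -[fg H]; split=> //; first exact: fP.
by move=> ij /PT; apply: H.
Qed.

Lemma T_absorb x y r : ker (phi w) x y -> T ++ t_ x y ++ r ~= T ++ r.
Proof.
move=> xy; have E : T ++ t_ x y ~= T.
  by apply: t_cokernel; apply/linked_phi => f g /crel_T[<-]; apply.
by rewrite catA E.
Qed.

Lemma T'_absorb x y : coker (phi w) x y -> t_ x y ++ T' ~= T'.
Proof.
by move=> xy; apply: t_kernel; apply/linked_phi => f g /crel_T'[<-]; apply.
Qed.

Lemma factors_exists : w <> [::] -> exists M, factors w M.
Proof.
move=> /factorisation[P [M M0 [Q E]]]; exists M; split=> //.
have wP ij : ij \in P -> ker (phi w) ij.1 ij.2.
  move=> ijP; apply/linked_phi => f g /(eqv_crel E)/crel_cat[h /crel_tword[_ fP] _].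
  exact: fP.
have wQ ij : ij \in Q -> coker (phi w) ij.1 ij.2.
  move=> ijQ; apply/linked_phi => f g /(eqv_crel E)/crel_cat[h1 _].
  by case/crel_cat=> h _ /crel_tword[<- hQ]; exact: hQ.
have TP r : T ++ t_word P ++ r ~= T ++ r.
  rewrite catA t_word_absorb_r // => ij /wP ijw.
  by apply/linked_phi => f g /crel_T[<-]; apply.
have QT : t_word Q ++ T' ~= T'.
  apply: t_word_absorb => ij /wQ ijw.
  by apply/linked_phi => f g /crel_T'[<-]; apply.
have Tw : T ++ w ~= w.
  have [P1 TP1 [P1T _]] := t_eqv_generates (ker_equiv (phi w)).
  by rewrite /T TP1; apply: t_word_absorb => ij /P1T.
have wT : w ++ T' ~= w.
  have [P1 TP1 [P1T _]] := t_eqv_generates (coker_equiv (phi w)).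
  by rewrite /T' TP1; apply: t_word_absorb_r => ij /P1T.
by rewrite -{1}Tw -{1}wT -/T -/T' [X in _ ++ X ++ _]E -!catA TP QT.
Qed.

Lemma crel_factors M f g : factors w M ->
  crel w f g <-> [/\ forall x y, ker (phi w) x y -> f x = f y,
                    forall x y, coker (phi w) x y -> g x = g y &
                    forall x, ~~ hole M x -> g (move_perm M x) = f x].
Proof.
case=> _ /eqv_sound ->; rewrite -/T -/T'; split.
  case/crel_cat=> h /crel_T[<- cf] /crel_cat[h' /crel_moves fh /crel_T'[<- cg]].
  by split.
case=> cf cg fg; apply/crel_cat; exists f; first exact/crel_T.
by apply/crel_cat; exists g; [apply/crel_moves | apply/crel_T'].
Qed.

Lemma linked_factors M x : factors w M -> ~~ hole M x ->
  linked (phi w) (inl x) (inr (move_perm M x)).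
Proof.
move=> wM Mx; apply/linked_phi => f g /(crel_factors _ _ wM)[_ _ fg].
by rewrite /= fg.
Qed.

Lemma ker_coker M x y : factors w M -> ~~ hole M x -> ~~ hole M y ->
  ker (phi w) x y = coker (phi w) (move_perm M x) (move_perm M y).
Proof.
move=> wM /(linked_factors wM) lx /(linked_factors wM) ly.
rewrite kerE cokerE.
have [_ /(_ lx)->] :=
  linked_equiv (phi w) (inl x) (inr (move_perm M x)) (inl y).
rewrite linked_sym.
have [_ /(_ ly)->] :=
  linked_equiv (phi w) (inl y) (inr (move_perm M y)) (inr (move_perm M x)).
exact: linked_sym.
Qed.

(** A lower point i that is not minimal in its class can be made a hole without
creating other non-minimal images.  If the minimum m is a hole, the token at i is
moved to m.  If m carries a token, the two tokens start in the same kernel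
class, and the one at i can be erased: by (R7), its connection is recovered
from the kernel factor on the left. *)
Lemma normalise_lower i M : factors w M -> ~~ is_rep (coker (phi w)) i ->
  exists2 N, factors w N & forall j, ~~ is_rep (coker (phi w)) j ->
    (forall x, ~~ hole N x -> move_perm N x = j ->
       j != i /\ exists2 y, ~~ hole M y & move_perm M y = j).
Proof.
move=> wM ri; have [M0 E] := wM; rewrite -/T -/T' in E.
have [m im rm] := rep_exists i (coker_equiv (phi w)).
have i'm : i != m by apply: contraNneq ri => ->.
have T'E : t_ i m ++ e_ i ++ T' ~= T'.
  by rewrite -{1}(T'_absorb im) tet // T'_absorb.
set x := (move_perm M)^-1 i; set y := (move_perm M)^-1 m.
have xE z : move_perm M z = i -> z = x by rewrite /x => <-; rewrite permK.
have yE z : move_perm M z = m -> z = y by rewrite /y => <-; rewrite permK.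
have [Mx|Mx] := boolP (hole M x).
  exists M => // j rj z Mz zj; split; last by exists z.
  by apply: contraNneq Mz => ji; rewrite (xE z) // -ji.
have [My|My] := boolP (hole M y).
  exists (M ++ [:: (m, i)]).
    split; first exact: cat1_neq0.
    rewrite -/T -/T' moves_rcons zE (t_sym m) moves_e_hole => [|z Mz].
      by rewrite T'E.
    by apply: contraNneq Mz => /yE->.
  move=> j rj z; rewrite hole_cat move_perm_cat /= orbF mulg1.
  case/norP=> Mz zm; case: tpermP => [/eqP|zi mj|_ zi <-].
  - by rewrite (negbTE zm).
  - by rewrite -mj rm in rj.
  - by split; [exact/eqP | exists z].
have xy : ker (phi w) x y by rewrite (ker_coker wM) // /x /y !permKV.
exists (M ++ [:: (i, i)]).
  split; first exact: cat1_neq0.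
  rewrite -/T -/T' moves_rcons zxx E -T'E -{1}(permKV (move_perm M) i) -/x.
  by rewrite -{1}(permKV (move_perm M) m) -/y moves_t // T_absorb // T'E.
move=> j rj z; rewrite hole_cat move_perm_cat /= orbF tperm1 mulg1 perm1.
case/norP=> Mz zi <-.
by split=> //; exists z.
Qed.

(** The same on the upper side, without changing the set of images except by
losing some of them. *)
Lemma normalise_upper x M : factors w M -> ~~ is_rep (ker (phi w)) x ->
  exists2 N, factors w N & forall z, ~~ hole N z ->
    (~~ is_rep (ker (phi w)) z -> z != x /\ ~~ hole M z) /\
    exists2 y, ~~ hole M y & move_perm M y = move_perm N z.
Proof.
move=> wM rx; have [M0 E] := wM; rewrite -/T -/T' in E.
have [Mx|Mx] := boolP (hole M x).
  exists M => // z Mz; split=> [_|]; last by exists z.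
  by split=> //; apply: contraNneq Mz => ->.
have [m xm rm] := rep_exists x (ker_equiv (phi w)).
have x'm : x != m by apply: contraNneq rx => ->.
have TE r : T ++ e_ x ++ t_ x m ++ r ~= T ++ r.
  by rewrite -(T_absorb _ xm) tet // T_absorb.
have [Mm|Mm] := boolP (hole M m).
  exists ((x, m) :: M).
    by split=> //; rewrite -/T -/T' moves_cons zE e_moves // TE.
  move=> z /= /norP[zx Mz]; split; last by exists (tperm x m z); rewrite ?permM.
  move=> rz; split=> //; rewrite tpermD // 1?eq_sym // in Mz.
  by apply: contraNneq rz => ->.
exists ((x, x) :: M).
  split=> //; rewrite -/T -/T' moves_cons zxx E -TE -moves_t // T'_absorb //.
  by rewrite -(ker_coker wM).
move=> z /= /norP[zx Mz]; rewrite tperm1 perm1 in Mz.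
by split=> //; exists z; rewrite // tperm1 mul1g.
Qed.

Lemma factors_normal : w <> [::] -> exists2 M, factors w M &
  forall x, ~~ hole M x ->
    is_rep (ker (phi w)) x /\ is_rep (coker (phi w)) (move_perm M x).
Proof.
case/factors_exists=> M0 wM0.
have [M wM Mlow] : exists2 M, factors w M &
    forall x, ~~ hole M x -> is_rep (coker (phi w)) (move_perm M x).
  suff [M wM MP] : exists2 M, factors w M & forall x, ~~ hole M x ->
      move_perm M x \in enum 'I_n -> is_rep (coker (phi w)) (move_perm M x).
    by exists M => // x Mx; apply: MP; rewrite // mem_enum.
  elim: (enum 'I_n) => [|i ps [M wM MP]]; first by exists M0.
  have [ri|ri] := boolP (is_rep (coker (phi w)) i).
    exists M => // x Mx; rewrite inE => /predU1P[->//|]; exact: MP.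
  have [N wN NP] := normalise_lower wM ri; exists N => // x Nx.
  rewrite inE => jps; apply: contraT => rj.
  have [ji [y My yj]] := NP _ rj x Nx (erefl _).
  by rewrite (negbTE ji) /= -yj in jps; rewrite -yj MP in rj.
suff [N wN [NP Nlow]] : exists2 N, factors w N &
    (forall x, ~~ hole N x -> x \in enum 'I_n -> is_rep (ker (phi w)) x) /\
    forall x, ~~ hole N x -> is_rep (coker (phi w)) (move_perm N x).
  by exists N => // x Nx; split; [apply: NP; rewrite // mem_enum | apply: Nlow].
elim: (enum 'I_n) => [|i ps [N wN [NP Nlow]]]; first by exists M.
have [ri|ri] := boolP (is_rep (ker (phi w)) i).
  exists N => //; split=> // x Nx; rewrite inE => /predU1P[->//|]; exact: NP.
have [N' wN' N'P] := normalise_upper wN ri; exists N' => //.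
split=> x N'x; have [xi [y Ny yx]] := N'P x N'x;
  last by rewrite -yx; apply: Nlow.
rewrite inE => xps; apply: contraT => rx; have [xi' Nx] := xi rx.
by rewrite (negbTE xi') /= in xps; rewrite NP in rx.
Qed.
End Sandwich.
End Factorisation.

(** * The theorem *)

Lemma gen_Z_moves n (v : word n) : in_gen_Z v ->
  exists2 N, N != [::] & v = moves N.
Proof.
elim=> {v} [i j _|u v _ [N N0 ->] _ [N' _ ->]].
  by exists [:: (i, j)]; rewrite // -[RHS]/(z_ i j ++ [::]) cats0.
by exists (N ++ N'); [case: N N0 | rewrite moves_cat].
Qed.

Lemma in_upper n (A : {set 'I_n}) (u : vertex n) :
  (u \in upper A) = if u is inl x then x \in A else false.
Proof.
case: u => x; first by rewrite mem_imset //; exact: inl_inj.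
by apply/imsetP => -[].
Qed.

Lemma in_lower n (A : {set 'I_n}) (u : vertex n) :
  (u \in lower A) = if u is inr x then x \in A else false.
Proof.
case: u => x; last by rewrite mem_imset //; exact: inr_inj.
by apply/imsetP => -[].
Qed.

Theorem proposition3p14 (n : nat) (hn : 2 <= n)
  (z : ptn n -> word n)
  (hz : forall al : ptn n, al \in in_In n -> al \notin in_Sn n ->
     in_gen_Z (z al) /\ phi (z al) = al)
  (w : word n) (hw : w <> [::])
  (r p q : nat) (A B : 'I_r -> {set 'I_n})
  (C : 'I_p -> {set 'I_n}) (D : 'I_q -> {set 'I_n})
  (hblocks : has_blocks (phi w) A B C D)
  (a b : 'I_r -> 'I_n)
  (ha : forall i, is_min (A i) (a i)) (hb : forall i, is_min (B i) (b i))
  (al : ptn n) (hal : al \in in_In n)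
  (hal_trans : [set X in blocks al | is_transv X]
     = [set [set inl (a i); inr (b i)] | i : 'I_r])
  (hal_sing : forall X, X \in blocks al -> ~~ is_transv X -> #|X| = 1) :
  sim w (t_eqv (ker (phi w)) ++ z al ++ t_eqv (coker (phi w))).
Proof.
have [M wM repM] := factors_normal hw.
have [M0 E] := wM.
have [blE _ inj _ _] := hblocks.
have /and3P[_ tI _] := blocksP (phi w).
pose X i := upper (A i) :|: lower (B i).
have XB i : X i \in blocks (phi w).
  by rewrite blE; apply/setUP; left; apply/setUP; left; apply: imset_f.
have inX x i : (inl x \in X i) = (x \in A i) by rewrite inE in_upper in_lower orbF.
have inX' x i : (inr x \in X i) = (x \in B i) by rewrite inE in_upper in_lower.
(* The tokens of M start at some a i and end at the corresponding b i... *)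
have abP x : ~~ hole M x -> exists2 i, x = a i & move_perm M x = b i.
  move=> Mx; have [xr yr] := repM x Mx.
  have /existsP[Y /and3P[YB xY yY]] := linked_factors wM Mx.
  have [i YX] : exists i, Y = X i.
    move: YB; rewrite blE => /setUP[/setUP[]|] /imsetP[i _ YE]; first by exists i.
      by move: yY; rewrite YE => /imsetP[].
    by move: xY; rewrite YE => /imsetP[].
  rewrite YX inX in xY; rewrite YX inX' in yY; exists i.
    have [aA aM] := ha i; apply/val_inj/eqP; rewrite eqn_leq aM // andbT.
    have /forallP/(_ (a i))/implyP := xr; apply; apply/existsP; exists (X i).
    by rewrite XB !inX xY.
  have [bB bM] := hb i; apply/val_inj/eqP; rewrite eqn_leq bM // andbT.
  have /forallP/(_ (b i))/implyP := yr; apply; apply/existsP; exists (X i).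
  by rewrite XB !inX' yY.
(* ...and every i occurs: otherwise a colouring supported by the class of a i
   alone would be compatible with the blocks. *)
have Mab i : ~~ hole M (a i) /\ move_perm M (a i) = b i.
  have /existsP[x /andP[Mx ax]] :
      [exists x, ~~ hole M x && ker (phi w) (a i) x].
    apply: contraT => /existsPn noM.
    have ab : linked (phi w) (inl (a i)) (inr (b i)).
      apply/existsP; exists (X i); rewrite XB inX inX'.
      by have [-> _] := ha i; have [-> _] := hb i.
    pose f := [ffun x => ker (phi w) (a i) x].
    pose g : {ffun 'I_n -> bool} := [ffun=> false].
    have /(iffLR (linked_phi _ _ _) ab) : crel w f g.
      apply/(crel_factors _ _ wM); split=> [x y xy|x y _|x Mx]; rewrite !ffunE //.
        apply/idP/idP => aix; apply: linked_trans aix _ => //.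
        by rewrite linked_sym.
      by have := noM x; rewrite Mx /= => /negbTE.
    by rewrite /= !ffunE kerE linked_refl.
  have [i' xi sx] := abP x Mx.
  suff <- : i' = i by rewrite -xi.
  apply: inj; case/existsP: ax => Y /and3P[YB aY xY].
  rewrite -/(X i) -/(X i').
  have iY j : inl (a j) \in Y -> X j = Y.
    move=> jY; rewrite -(def_pblock tI YB jY); symmetry; apply: def_pblock => //.
    by rewrite inX; case: (ha j).
  by rewrite !iY // -xi.
have alnS : al \notin in_Sn n.
  have [k Mk] : exists k, hole M k.
    by case: (M) M0 => // -[k j] N _; exists k; rewrite /= eqxx.
  suff : rank al < n by rewrite ltn_neqAle => /andP[].
  have lt_n : #|[set x | ~~ hole M x]| < n.
    rewrite -[X in _ < X]card_ord -cardsT; apply: proper_card.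
    by rewrite properT; apply/eqP => /setP/(_ k); rewrite !inE Mk.
  apply: leq_ltn_trans lt_n; rewrite /rank hal_trans.
  apply: leq_trans (leq_imset_card (fun x => [set inl x; inr (move_perm M x)]) _).
  apply/subset_leq_card/subsetP => _ /imsetP[i _ ->]; have [Mi <-] := Mab i.
  by apply: imset_f; rewrite inE.
have [/gen_Z_moves[N N0 zN] phiz] := hz _ hal alnS.
have MN : moves M ~= moves N.
  apply: moves_complete => // f g; rewrite -zN crel_moves crel_phi phiz.
  split=> [fg u v /existsP[Y /and3P[YB uY vY]]|fg x /abP[i -> ->]].
    have [tY|tY] := boolP (is_transv Y).
      have : Y \in [set X in blocks al | is_transv X] by rewrite inE YB.
      rewrite hal_trans => /imsetP[i _ YE]; have [Mi Mai] := Mab i.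
      have := fg _ Mi; rewrite Mai => fgi.
      by move: uY vY; rewrite YE => /set2P[]-> /set2P[]->.
    have /eqP/cards1P[y Yy] := hal_sing Y YB tY.
    by move: uY vY; rewrite Yy => /set1P-> /set1P->.
  symmetry; apply: (fg (inl _) (inr _)); apply/existsP.
  exists [set inl (a i); inr (b i)]; rewrite set21 set22 !andbT.
  have : [set inl (a i); inr (b i)] \in [set X in blocks al | is_transv X].
    by rewrite hal_trans; apply/imsetP; exists i.
  by rewrite inE => /andP[].
by apply: eqv_sim => //; rewrite zN -MN.
Qed.
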